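(* Let $\{r_i\}_{i=1}^\infty$ be the sequence of all rational numbers in lowest terms in the open interval $(0,1)$, ordered first by increasing denominator and, for equal denominators, by increasing numerator: \[ r_1=\tfrac12,\ r_2=\tfrac13,\ r_3=\tfrac23,\ r_4=\tfrac14,\ r_5=\tfrac34,\ \dots \] For a rational $r\in(0,1)$ let $L(r)$ denote the number of digits in its (finite) continued fraction expansion. Let $f:\mathbb{N}\to\mathbb{N}$ and let $x_f$ be the real number whose continued fraction expansion is obtained by concatenating, in order, the finite continued fraction expansions of $r_{f(1)}, r_{f(2)}, r_{f(3)},\dots$. Suppose that \[ N= o\Big( \sum_{n=1}^N L(r_{f(n)}) \Big) \quad\text{and}\quad N\cdot \max_{1\le n \le N} L(r_{f(n)}) = O\Big( \sum_{n=1}^N L(r_{f(n)})\Big) \] as $N\to\infty$, and that for every set $S\subset\mathbb{N}$ with $\#\{n\in S: n\le x\}=O(x/\log x)$, the set $f^{-1}(S)$ has asymptotic density $0$. Then $x_f$ is CF-normal.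
   Context: Every $x\in[0,1)$ has a continued fraction expansion $x=\langle a_1,a_2,\dots\rangle=1/(a_1+1/(a_2+\cdots))$ with $a_i\in\mathbb{N}$; it is infinite and unique for irrational $x$. A rational number has two finite expansions (one ending in a digit $\ge 2$, one ending in $1$); by convention the longer one (ending in the digit $1$) is always used. The Gauss measure is $\mu(A)=\frac{1}{\log 2}\int_A \frac{dx}{1+x}$. For a finite string $s=[d_1,\dots,d_k]$ of positive integers, the cylinder set is $C_s=\{x\in[0,1): a_i(x)=d_i,\ 1\le i\le k\}$. For real $x$, $A_s(N;x)$ is the number of indices $1\le i\le N$ such that the string $s$ occurs in the continued fraction expansion of $x$ starting at digit $a_i$. A number $x\in[0,1)$ is CF-normal if $\lim_{N\to\infty}A_s(N;x)/N=\mu(C_s)$ for every finite string $s$ of positive integers. A set $S\subset\mathbb{N}$ has asymptotic density $\rho$ if $\#\{n\le N:n\in S\}/N\to\rho$. *)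

(* Defs.v *)
From HB Require Import structures.
From mathcomp Require Import all_boot all_order all_algebra.
From mathcomp Require Import all_classical all_reals all_analysis.
Set Implicit Arguments. Unset Strict Implicit. Unset Printing Implicit Defensive.
Import Order.TTheory GRing.Theory Num.Theory.
Import numFieldNormedType.Exports.
Local Open Scope classical_set_scope.
Local Open Scope ring_scope.

Fixpoint cf_greedy (fuel p q : nat) : seq nat :=
  match fuel with
  | 0 => [::]
  | fuel'.+1 => if p == 0%N then [::] else (q %/ p)%N :: cf_greedy fuel' (q %% p) p
  end.

(* The finite CF expansion of p/q in (0,1) with the paper's convention:
   the longer expansion, ending in the digit 1 ( ..., a_k with a_k >= 2
   becomes ..., a_k - 1, 1 ). *)
Definition cf_rat (r : nat * nat) : seq nat :=
  let s := cf_greedy r.2.+1 r.1 r.2 in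
  if s is a :: s' then
    let l := last a s' in
    if (1 < l)%N then rcons (rcons (belast a s') l.-1) 1 else s
  else s.

Definition Lcf (r : nat * nat) : nat := size (cf_rat r).

Definition rat_list (Q : nat) : seq (nat * nat) :=
  flatten [seq [seq (p, q) | p <- iota 1 q.-1 & coprime p q] | q <- iota 2 Q].

(* r_i (i >= 1): the i-th reduced fraction in (0,1) in the above order
   (r_1 = 1/2, r_2 = 1/3, r_3 = 2/3, r_4 = 1/4, ...). The list rat_list i
   has at least i elements, and these lists are prefixes of each other. *)
Definition rseq (i : nat) : nat * nat := nth (0%N, 1%N) (rat_list i) i.-1.

Definition xf_prefix (f : nat -> nat) (N : nat) : seq nat :=
  flatten [seq cf_rat (rseq (f n)) | n <- iota 1 N].

Definition xf_digit (f : nat -> nat) (i : nat) : nat := nth 0%N (xf_prefix f i) i.-1.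

Definition SL (f : nat -> nat) (N : nat) : nat := (\sum_(1 <= n < N.+1) Lcf (rseq (f n)))%N.
Definition ML (f : nat -> nat) (N : nat) : nat := (\max_(1 <= n < N.+1) Lcf (rseq (f n)))%N.

Definition count_upto (S : pred nat) (N : nat) : nat := count S (iota 1 N).

Definition density_zero {R : realType} (S : pred nat) : Prop :=
  (fun N : nat => (count_upto S N)%:R / (N%:R : R)) @ \oo --> (0 : R).

Definition gauss_map {R : realType} (x : R) : R :=
  if x == 0 then 0 else x^-1 - (Num.floor (x^-1))%:~R.

Definition cf_digit {R : realType} (x : R) (i : nat) : nat :=
  Num.truncn ((iter i.-1 gauss_map x)^-1).

Definition gauss_measure {R : realType} (A : set R) : \bar R :=
  (\int[@lebesgue_measure R]_(y in A) ((1 + y)^-1 / ln 2)%:E)%E.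

Definition cylinder {R : realType} (s : seq nat) : set R :=
  [set x | 0 <= x < 1 /\ forall j, (j < size s)%N -> cf_digit x j.+1 = nth 0%N s j].

Definition occ_count {R : realType} (s : seq nat) (N : nat) (x : R) : nat :=
  count (fun i => all (fun j => cf_digit x (i + j) == nth 0%N s j) (iota 0 (size s)))
        (iota 1 N).

Definition CF_normal {R : realType} (x : R) : Prop :=
  forall s : seq nat, (0 < size s)%N -> all (fun d => 0 < d)%N s ->
    (fun N : nat => ((occ_count s N x)%:R / (N%:R : R))%:E) @ \oo
      --> gauss_measure (@cylinder R s).

(* Main.v *)
(* The cylinder of the digit word of a fraction with denominator q has length at least
   1/(2 q^2), and the squares of the continuants at most m of the prefixes of one
   digit sequence sum to at most 2 m^2. So the number of words with continuant at most
   m and at least c log m digits in which s has the wrong frequency is at most 4 m^2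
   times the probability that a random digit sequence has such a prefix; shorter words
   are rare by Rankin's trick with exponent 3/2.
   Under Lebesgue measure the ratio t of the last two convergent denominators is a
   Markov chain t -> 1/(d+t). Its transfer operator reverses monotonicity, and it maps
   the increasing function t/(1+2t) to 1/(2(2+t)), up to the truncation of large
   digits, whose variation is at most half as large; hence it halves the variation of
   every function measured by that gauge. The resulting exponential mixing bounds the
   variance of the number of occurrences of s in k digits by O(k), and Chebyshev's
   inequality on a grid of boundedly many lengths gives probability O(1/log m). Thus
   the exceptional indices have counting function O(x/log x), their preimage under f
   has density zero, and the two growth hypotheses make the contribution of
   exceptional blocks and of block boundaries negligible. *)
Require Import Defs.
From HB Require Import structures.
From mathcomp Require Import all_boot all_order all_algebra.
From mathcomp Require Import all_classical all_reals all_analysis.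
From mathcomp Require Import measurable_realfun.
From mathcomp Require Import zify ring lra.
Set Implicit Arguments. Unset Strict Implicit. Unset Printing Implicit Defensive.
Import Order.TTheory GRing.Theory Num.Theory.
Import numFieldNormedType.Exports.
Local Open Scope classical_set_scope.
Local Open Scope ring_scope.

(** * Words and occurrences *)

Lemma ler_sum_sub (R : numDomainType) (T : eqType) (r1 r2 : seq T) (F : T -> R) :
  uniq r1 -> {subset r1 <= r2} -> (forall x, 0 <= F x) ->
  \sum_(x <- r1) F x <= \sum_(x <- r2) F x.
Proof.
move=> + + F0; elim: r1 r2 => [|x r1 IH] r2 /=; first by rewrite big_nil sumr_ge0.
move=> /andP[xr1 u1] sub; have xr2 : x \in r2 by rewrite sub ?mem_head.
rewrite (perm_big _ (perm_to_rem xr2)) !big_cons lerD2l; apply: IH => // y yr1.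
have : y \in x :: rem x r2 by rewrite -(perm_mem (perm_to_rem xr2)) sub // in_cons yr1 orbT.
by rewrite in_cons => /orP[/eqP yx|//]; rewrite -yx yr1 in xr1.
Qed.

Section Words.
Context {T : eqType}.
Implicit Types (A s u v w : seq T) (k : nat).

Fixpoint words A k : seq (seq T) :=
  if k is k'.+1 then [seq a :: w | a <- A, w <- words A k'] else [:: [::]].

Lemma mem_words A k u : (u \in words A k) = (size u == k) && all [in A] u.
Proof.
elim: k u => [|k IH] [|a u] //=; first by apply/allpairsP => -[[? ?] []].
apply/allpairsP/idP => [[[b w]] /= [bA + [-> ->]]|/and3P[uk aA uA]].
  by rewrite IH eqSS bA.
by exists (a, u); rewrite /= IH aA -eqSS uk.
Qed.

Lemma size_words A k u : u \in words A k -> size u = k.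
Proof. by rewrite mem_words => /andP[/eqP]. Qed.

Lemma words_uniq A k : uniq A -> uniq (words A k).
Proof.
move=> uA; elim: k => //= k IH; apply: allpairs_uniq => //.
by move=> [a u] [b v] _ _ /= [-> ->].
Qed.

Lemma sum_words_prod (R : pzSemiRingType) A k (f : T -> R) :
  \sum_(w <- words A k) \prod_(a <- w) f a = (\sum_(a <- A) f a) ^+ k.
Proof.
elim: k => [|k IH]; first by rewrite big_seq1 big_nil.
rewrite exprS -IH big_distrl /= big_allpairs_dep; apply: eq_bigr => a _.
by rewrite big_distrr; apply: eq_bigr => w _; rewrite big_cons.
Qed.

Lemma prefix_cat_le s v w : (size s <= size v)%N -> prefix s (v ++ w) = prefix s v.
Proof. by move=> sv; rewrite !prefixE takel_cat. Qed.

Fixpoint occ s w : nat := if w is _ :: w' then prefix s w + occ s w' else 0.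

Lemma occ_cons s a w : occ s (a :: w) = (prefix s (a :: w) + occ s w)%N.
Proof. by []. Qed.

Lemma occE s w : occ s w = count (fun i => prefix s (drop i w)) (iota 0 (size w)).
Proof.
elim: w => // a w IH; rewrite occ_cons IH /= -[1%N]/(1 + 0)%N iotaDl count_map.
by congr addn; apply: eq_count.
Qed.

Lemma occ_le_size s w : (0 < size s)%N -> (occ s w <= (size w).+1 - size s)%N.
Proof.
move=> s0; elim: w => // a w; rewrite occ_cons.
by case: (boolP (prefix s _)) => [/size_prefix|_] /=; lia.
Qed.

Lemma occ_cat_bounds s v u : (0 < size s)%N ->
  (occ s v <= occ s (v ++ u) <= occ s v + size u)%N.
Proof.
move=> s0; elim: v => [|a v IH]; first by have := occ_le_size u s0; rewrite /=; lia.
rewrite cat_cons !occ_cons -cat_cons.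
have [sv|vs] := leqP (size s) (size (a :: v)); first by rewrite prefix_cat_le //; lia.
have -> : prefix s (a :: v) = false by apply/negP => /size_prefix; rewrite leqNgt vs.
apply/andP; split; first by lia.
by apply: leq_trans (occ_le_size ((a :: v) ++ u) s0) _; rewrite size_cat; move: vs => /=; lia.
Qed.

Lemma occ_cat s v u :
  (occ s v + occ s u <= occ s (v ++ u) <= occ s v + occ s u + minn (size v) (size s))%N.
Proof.
elim: v => [|a v IH]; first by rewrite min0n addn0 leqnn.
rewrite cat_cons !occ_cons -cat_cons.
have [sv|vs] := leqP (size s) (size (a :: v)).
  by rewrite prefix_cat_le //; move: IH sv => /=; lia.
have -> : prefix s (a :: v) = false by apply/negP => /size_prefix; rewrite leqNgt vs.
by move: IH vs; case: (prefix s _) => /=; lia.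
Qed.

(* The windows of [a] of length [size s] that stick out of [mkseq a N] are the
   only ones that [occ] misses. *)
Lemma occ_mkseq s (a : nat -> T) N : (0 < size s)%N ->
  (occ s (mkseq a N) <= count (fun i => mkseq (fun j => a (i + j)) (size s) == s) (iota 0 N)
     <= occ s (mkseq a N) + size s)%N.
Proof.
move=> s0; set P := fun i => mkseq _ _ == s.
have prefixP M i : (i < M)%N -> prefix s (drop i (mkseq a M)) = (i + size s <= M)%N && P i.
  move=> iM; rewrite /mkseq -map_drop drop_iota prefixE -map_take take_iota add0n.
  rewrite /P /mkseq -[i]addn0 iotaDl -map_comp addn0.
  have [le|lt] := leqP (i + size s) M; first by rewrite (minn_idPl _) //; lia.
  by apply/negP => /eqP/(congr1 size); rewrite size_map size_iota; lia.
have countE M : occ s (mkseq a M) = count (fun i => (i + size s <= M)%N && P i) (iota 0 M).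
  rewrite occE size_mkseq; apply: eq_in_count => i; rewrite mem_iota => iM.
  exact: prefixP.
apply/andP; split; first by rewrite countE; apply: sub_count => i /= /andP[].
have /andP[_] := occ_cat_bounds (mkseq a N) (map a (iota N (size s))) s0.
rewrite size_map size_iota -map_cat -iotaD -/(mkseq a _); apply: leq_trans.
rewrite countE iotaD count_cat; apply: leq_trans (leq_addr _ _).
rewrite leq_eqVlt; apply/orP; left; apply/eqP/eq_in_count => i; rewrite mem_iota => iN.
by rewrite leq_add2r ltnW.
Qed.

End Words.

(** * Chains driven by letters *)

Section SuffixSum.
Context {R : numDomainType} {T : eqType}.
Variable Y : seq T -> R.
Implicit Types u v : seq T.

Fixpoint suffix_sum u : R := if u is _ :: v then Y u + suffix_sum v else 0.

Lemma suffix_sum_drop n u : (n <= size u)%N ->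
  suffix_sum u = \sum_(0 <= i < n) Y (drop i u) + suffix_sum (drop n u).
Proof.
elim: n => [|n IH] nu; first by rewrite big_geq // add0r drop0.
rewrite IH ?(ltnW nu) // big_nat_recr //= -addrA; congr (_ + _).
rewrite -(add1n n) -drop_drop; case: (drop n u) (size_drop n u) => /= [|a v _]; first by lia.
by rewrite drop0.
Qed.

Hypothesis Y_le1 : forall u, `|Y u| <= 1.

Lemma suffix_sum_cat_dist v u : `|suffix_sum (v ++ u) - suffix_sum u| <= (size v)%:R.
Proof.
elim: v => [|a v IH] /=; first by rewrite subrr normr0.
by rewrite -addrA -natr1 addrC (le_trans (ler_normD _ _)) // lerD.
Qed.

Lemma suffix_sum_le_size u : `|suffix_sum u| <= (size u)%:R.
Proof. by have := suffix_sum_cat_dist u [::]; rewrite cats0 subr0. Qed.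

End SuffixSum.

Section Chain.
Context {R : realFieldType} {S : Type} {T : eqType}.
Variable next : S -> T -> S.
Implicit Types (x : S) (A : seq T) (p q : S -> T -> R) (k : nat) (c : R)
  (u v w : seq T) (F G : seq T -> R).

Local Notation run := (foldl next).

Fixpoint path_weight p x u : R :=
  if u is a :: v then p x a * path_weight p (next x a) v else 1.

Definition expect p A k x F : R := \sum_(u <- words A k) path_weight p x u * F u.

Definition transfer p A (h : S -> R) x : R := \sum_(a <- A) p x a * h (next x a).

Lemma path_weight_cat p x u v :
  path_weight p x (u ++ v) = path_weight p x u * path_weight p (run x u) v.
Proof. by elim: u x => [|a u IH] x /=; rewrite ?mul1r // IH mulrA. Qed.

Lemma expect0 p A x F : expect p A 0 x F = F [::].
Proof. by rewrite /expect big_seq1 mul1r. Qed.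

Lemma expectS p A k x F :
  expect p A k.+1 x F = \sum_(a <- A) p x a * expect p A k (next x a) (fun u => F (a :: u)).
Proof.
rewrite /expect /= big_allpairs_dep; apply: eq_bigr => a _; rewrite big_distrr /=.
by apply: eq_bigr => w _; rewrite mulrA.
Qed.

Lemma eq_expect p A k x F G : (forall u, u \in words A k -> F u = G u) ->
  expect p A k x F = expect p A k x G.
Proof. by move=> FG; apply: eq_big_seq => u /FG ->. Qed.

Lemma expectD p A k x F G :
  expect p A k x (fun u => F u + G u) = expect p A k x F + expect p A k x G.
Proof. by rewrite /expect -big_split; apply: eq_bigr => u _ /=; rewrite mulrDr. Qed.

Lemma expectZ p A k x c F : expect p A k x (fun u => c * F u) = c * expect p A k x F.
Proof. by rewrite /expect big_distrr; apply: eq_bigr => u _ /=; rewrite mulrCA. Qed.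

Lemma expect_sum p A k x (I : Type) (r : seq I) (P : pred I) (F : I -> seq T -> R) :
  expect p A k x (fun u => \sum_(i <- r | P i) F i u) = \sum_(i <- r | P i) expect p A k x (F i).
Proof. by rewrite /expect exchange_big; apply: eq_bigr => u _ /=; rewrite big_distrr. Qed.

Lemma expect_cat p A j k x F :
  expect p A (j + k) x F = expect p A j x (fun v => expect p A k (run x v) (fun w => F (v ++ w))).
Proof.
elim: j x F => [|j IH] x F; first by rewrite expect0.
by rewrite addSn !expectS; apply: eq_bigr => a _; rewrite IH.
Qed.

Lemma expect_drop p A j k x F :
  expect p A (j + k) x (fun u => F (drop j u)) = expect p A j x (fun v => expect p A k (run x v) F).
Proof.
rewrite expect_cat; apply: eq_expect => v /size_words vj.
by apply: eq_expect => w _; rewrite -vj drop_size_cat.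
Qed.

Lemma iter_transfer p A k h x :
  iter k (transfer p A) h x = expect p A k x (fun u => h (run x u)).
Proof.
elim: k x => [|k IH] x; first by rewrite expect0.
by rewrite iterS /transfer expectS; apply: eq_bigr => a _; rewrite IH.
Qed.

Record stochastic p A (good : pred S) : Prop := Stochastic {
  stochastic_ge0 : forall x a, good x -> a \in A -> 0 <= p x a;
  stochastic_sum : forall x, good x -> \sum_(a <- A) p x a = 1;
  stochastic_next : forall x a, good x -> a \in A -> good (next x a) }.

Section Stochastic.
Variables (p : S -> T -> R) (A : seq T) (good : pred S).
Hypothesis chain : stochastic p A good.
Local Notation E := (expect p A).

Lemma stochastic_run x u : good x -> all [in A] u -> good (run x u).
Proof. by elim: u x => //= a u IH x gx /andP[aA uA]; rewrite IH ?(stochastic_next chain). Qed.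

Lemma path_weight_le q x u :
  (forall y a, good y -> a \in A -> 0 <= q y a <= p y a) -> good x -> all [in A] u ->
  0 <= path_weight q x u <= path_weight p x u.
Proof.
move=> qp; elim: u x => [|a u IH] x gx /= => [_|/andP[aA uA]]; first by rewrite ler01 lexx.
have /andP[q0 qle] := qp _ _ gx aA.
have /andP[w0 wle] := IH _ (stochastic_next chain gx aA) uA.
by rewrite mulr_ge0 //= ler_pM.
Qed.

Lemma path_weight_ge0 x u : good x -> all [in A] u -> 0 <= path_weight p x u.
Proof.
move=> gx uA; have pp y a : good y -> a \in A -> 0 <= p y a <= p y a.
  by move=> gy aA; rewrite lexx andbT (stochastic_ge0 chain).
by case/andP: (path_weight_le pp gx uA).
Qed.

Lemma le_expect k x F G : good x -> (forall u, u \in words A k -> F u <= G u) ->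
  E k x F <= E k x G.
Proof.
move=> gx FG; rewrite /expect big_seq [leRHS]big_seq ler_sum // => u uk.
by rewrite ler_wpM2l ?FG // path_weight_ge0 //; move: uk; rewrite mem_words => /andP[].
Qed.

Lemma expect_cst k x c : good x -> E k x (fun=> c) = c.
Proof.
elim: k x => [|k IH] x gx; first by rewrite expect0.
rewrite expectS -[RHS]mul1r -(stochastic_sum chain gx) big_distrl /=.
by apply: eq_big_seq => a aA; rewrite IH // (stochastic_next chain).
Qed.

Lemma expect_le k x F c : good x -> (forall u, u \in words A k -> F u <= c) -> E k x F <= c.
Proof. by move=> gx Fc; rewrite -[leRHS](expect_cst k c gx) le_expect. Qed.

Lemma expect_ge k x F c : good x -> (forall u, u \in words A k -> c <= F u) -> c <= E k x F.
Proof. by move=> gx Fc; rewrite -[leLHS](expect_cst k c gx) le_expect. Qed.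

Lemma ler_norm_expect k x F c : good x -> (forall u, u \in words A k -> `|F u| <= c) ->
  `|E k x F| <= c.
Proof.
move=> gx Fc; rewrite ler_norml; apply/andP; split.
  by apply: expect_ge => // u /Fc; rewrite ler_norml => /andP[].
by apply: expect_le => // u /Fc; rewrite ler_norml => /andP[].
Qed.

Lemma expect_take j k x F : (j <= k)%N -> good x -> E k x (fun u => F (take j u)) = E j x F.
Proof.
move=> /subnKC <- gx; rewrite expect_cat; apply: eq_expect => v.
rewrite mem_words => /andP[/eqP <- vA].
under eq_expect => w _ do rewrite take_size_cat //.
by rewrite expect_cst // stochastic_run.
Qed.

Lemma expect_prefix k x w : uniq A -> all [in A] w -> (size w <= k)%N -> good x ->
  E k x (fun u => (prefix w u)%:R) = path_weight p x w.
Proof.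
move=> uA wA wk gx; under eq_expect => u _ do rewrite prefixE eq_sym.
rewrite (@expect_take _ _ _ (fun v => (w == v)%:R)) // /expect.
rewrite (bigD1_seq w) ?words_uniq ?mem_words ?eqxx //= mulr1 big1 ?addr0 // => v.
by rewrite eq_sym => /negbTE ->; rewrite mulr0.
Qed.

Lemma expect_chebyshev k x F c : good x -> 0 < c ->
  E k x (fun u => (c < `|F u|)%R%:R) <= E k x (fun u => F u ^+ 2) / c ^+ 2.
Proof.
move=> gx c0; rewrite ler_pdivlMr ?exprn_gt0 // mulrC -expectZ; apply: le_expect => // u _.
case: ltP => [cF|_]; last by rewrite mulr0 sqr_ge0.
by rewrite mulr1 -[leRHS]real_normK ?num_real // ler_pXn2r ?nnegrE ?normr_ge0 ?ltW.
Qed.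

Lemma expect_sub_le q (e : R) k x F :
  (forall y a, good y -> a \in A -> 0 <= q y a <= p y a) ->
  (forall y, good y -> \sum_(a <- A) (p y a - q y a) <= e) ->
  (forall u, u \in words A k -> 0 <= F u <= 1) -> good x ->
  0 <= E k x F - expect q A k x F <= k%:R * e.
Proof.
move=> qp pqe; elim: k x F => [|k IH] x F F01 gx.
  by rewrite !expect0 subrr mul0r lexx.
have Fa a : a \in A -> forall u, u \in words A k -> 0 <= F (a :: u) <= 1.
  by move=> aA u uk; apply: F01; rewrite /= (allpairs_f (fun b v => b :: v)).
have step a : a \in A -> 0 <= p x a * E k (next x a) (fun u => F (a :: u))
    - q x a * expect q A k (next x a) (fun u => F (a :: u))
    <= (p x a - q x a) + k%:R * e * p x a.
  move=> aA; have gy := stochastic_next chain gx aA.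
  have /andP[q0 qle] := qp _ _ gx aA; have /andP[d0 d1] := IH _ _ (Fa a aA) gy.
  have Ep0 : 0 <= E k (next x a) (fun u => F (a :: u)).
    by apply: expect_ge => // u /(Fa a aA)/andP[].
  have Ep1 : E k (next x a) (fun u => F (a :: u)) <= 1.
    by apply: expect_le => // u /(Fa a aA)/andP[].
  move: (E k _ _) (expect q A k _ _) d0 d1 Ep0 Ep1 => Ep Eq d0 d1 Ep0 Ep1.
  have -> : p x a * Ep - q x a * Eq = (p x a - q x a) * Ep + q x a * (Ep - Eq) by ring.
  apply/andP; split; first by apply: addr_ge0; apply: mulr_ge0; rewrite // subr_ge0.
  by rewrite lerD // ?ler_piMr ?subr_ge0 // [leRHS]mulrC ler_pM.
rewrite !expectS -sumrB; apply/andP; split.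
  by rewrite big_seq sumr_ge0 // => a /step/andP[].
apply: (@le_trans _ _ (\sum_(a <- A) ((p x a - q x a) + k%:R * e * p x a))).
  by rewrite big_seq [leRHS]big_seq ler_sum // => a /step/andP[].
rewrite big_split -big_distrr /= (stochastic_sum chain gx) mulr1 -natr1 mulrDl mul1r addrC.
by rewrite lerD2l pqe.
Qed.

Section LocalObservable.
Variables (l : nat) (Y : seq T -> R).
Hypothesis Y_le1 : forall u, `|Y u| <= 1.
Hypothesis Y_local : forall u v, (l <= size u)%N -> Y (u ++ v) = Y u.
Local Notation Z := (suffix_sum Y).

Lemma suffix_sum_mean_bound k x : good x ->
  `|E k x Z| <=
    \sum_(0 <= i < k - l) `|E i x (fun v => E (k - i) (run x v) Y)| + l%:R.
Proof.
move=> gx; set n := (k - l)%N.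
have -> : E k x Z = \sum_(0 <= i < n) E k x (fun u => Y (drop i u)) + E k x (fun u => Z (drop n u)).
  rewrite -expect_sum -expectD; apply: eq_expect => u /size_words uk.
  by rewrite -suffix_sum_drop // uk leq_subr.
apply: le_trans (ler_normD _ _) _; apply: lerD; last first.
  apply: ler_norm_expect => // u /size_words uk.
  by apply: le_trans (suffix_sum_le_size Y_le1 _) _; rewrite size_drop uk ler_nat; lia.
apply: le_trans (ler_norm_sum _ _ _) _; apply: ler_sum_nat => i ik.
by rewrite -expect_drop subnKC //; lia.
Qed.

Variables (n : nat) (K : R).
Hypothesis mean_bound : forall k x, (k <= n)%N -> good x -> `|E k x Z| <= K.

Lemma suffix_sum_covariance_bound k x : (0 < l)%N -> (k < n)%N -> good x ->
  `|E k.+1 x (fun u => Y u * Z (behead u))| <= l%:R + K.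
Proof.
move=> l0 kn gx; have K0 : 0 <= K by apply: le_trans (mean_bound (ltnW kn) gx).
have YM u (z c : R) : `|z| <= c -> `|Y u * z| <= c.
  by move=> zc; rewrite normrM (le_trans (ler_piMl _ (Y_le1 _))).
have [kl|lk] := leqP k.+1 l.
  apply: ler_norm_expect => // u /size_words uk; apply: YM.
  apply: le_trans (suffix_sum_le_size Y_le1 _) _; rewrite size_behead uk /=.
  by apply: ler_wpDr => //; rewrite ler_nat ltnW.
have -> : E k.+1 x (fun u => Y u * Z (behead u)) =
    E k.+1 x (fun u => Y u * (Z (behead u) - Z (drop l u))) +
    E k.+1 x (fun u => Y u * Z (drop l u)).
  by rewrite -expectD; apply: eq_expect => u _; rewrite -mulrDr subrK.
apply: le_trans (ler_normD _ _) _; apply: lerD.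
  apply: ler_norm_expect => // u /size_words uk; apply: YM.
  have -> : drop l u = drop l.-1 (behead u) by rewrite -drop1 drop_drop addn1 prednK.
  rewrite -{1}(cat_take_drop l.-1 (behead u)).
  apply: le_trans (suffix_sum_cat_dist Y_le1 _ _) _; rewrite ler_nat.
  by rewrite size_take_min; lia.
have -> : E k.+1 x (fun u => Y u * Z (drop l u)) =
    E l x (fun v => Y v * E (k.+1 - l) (run x v) Z).
  rewrite -{1}(subnKC (ltnW lk)) expect_cat; apply: eq_expect => v /size_words vl.
  by rewrite -expectZ; apply: eq_expect => w _; rewrite -vl drop_size_cat // Y_local ?vl.
apply: ler_norm_expect => // v; rewrite mem_words => /andP[/eqP vl vA]; apply: YM.
by apply: mean_bound; [lia|apply: stochastic_run].
Qed.

(* Expanding [Z u = Y u + Z (behead u)] reduces the second moment to the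
   covariances of [Y u] with the sum over the remaining suffixes. *)
Lemma suffix_sum_variance_bound k x : (0 < l)%N -> (k <= n)%N -> good x ->
  E k x (fun u => Z u ^+ 2) <= k%:R * (1 + 2 * (l%:R + K)).
Proof.
move=> l0; elim: k x => [|k IH] x kn gx; first by rewrite expect0 expr0n mul0r.
have -> : E k.+1 x (fun u => Z u ^+ 2) = E k.+1 x (fun u => Y u ^+ 2) +
    2 * E k.+1 x (fun u => Y u * Z (behead u)) + E (1 + k) x (fun u => Z (drop 1 u) ^+ 2).
  rewrite -expectZ -!expectD; apply: eq_expect => -[|a u]; rewrite mem_words //= => _.
  by rewrite drop0; ring.
rewrite (expect_drop _ _ 1 k x (fun u => Z u ^+ 2)) -(natr1 k) [leRHS]mulrDl mul1r addrC lerD //.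
  apply: expect_le => // v; rewrite mem_words => /andP[_ vA].
  by apply: IH; [apply: ltnW|apply: stochastic_run].
have := suffix_sum_covariance_bound l0 kn gx; rewrite ler_norml => /andP[_ cov].
rewrite lerD //; last by rewrite ler_pM2l.
by apply: expect_le => // u _; rewrite -real_normK ?num_real // expr_le1.
Qed.

End LocalObservable.
End Stochastic.
End Chain.

(** * The digit chain and the contraction of its transfer operator *)

Definition digits D : seq nat := index_iota 1 D.+1.

Definition pos_digits (w : seq nat) : bool := all (fun d => 0 < d)%N w.

Lemma pos_digits_cat v w : pos_digits (v ++ w) = pos_digits v && pos_digits w.
Proof. exact: all_cat. Qed.

Lemma mem_digits D d : (d \in digits D) = (0 < d <= D)%N.
Proof. by rewrite mem_index_iota ltnS. Qed.

Lemma all_digits D w : all [in digits D] w = pos_digits w && all (fun d => d <= D)%N w.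
Proof. by rewrite -all_predI; apply: eq_all => d; exact: mem_digits. Qed.

Lemma words_pos_digits D k w : w \in words (digits D) k -> pos_digits w.
Proof. by rewrite mem_words all_digits => /and3P[]. Qed.

Section DigitChain.
Context {R : realFieldType}.
Implicit Types (t x : R) (F : R -> R) (d D k : nat) (s : seq nat).

(* If [t] is the ratio of the last two convergent denominators, [digit_tail t d] is
   the Lebesgue probability that the next digit is at least [d], and [next_ratio t d]
   is the new ratio once the digit [d] has been read. [capped_prob D] moves the mass
   of all digits above [D] to [D], which keeps every sum finite. *)
Definition digit_tail t d : R := (1 + t) / (d%:R + t).
Definition digit_prob t d : R := digit_tail t d - digit_tail t d.+1.
Definition capped_prob D t d : R := if (d < D)%N then digit_prob t d else digit_tail t d.
Definition next_ratio t d : R := (d%:R + t)^-1.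

Definition in01 t : bool := 0 <= t <= 1.

Lemma digit_ge1 d : (0 < d)%N -> 1 <= d%:R :> R.
Proof. by rewrite ler1n. Qed.

Lemma next_ratio01 t d : in01 t -> (0 < d)%N -> in01 (next_ratio t d).
Proof. by move=> /andP[t0 t1] /digit_ge1 d1; rewrite /in01 invr_ge0 invf_le1; lra. Qed.

Lemma next_ratio_anti d t t' : (0 < d)%N -> 0 <= t -> t <= t' ->
  next_ratio t' d <= next_ratio t d.
Proof. by move=> /digit_ge1 d1 t0 tt; rewrite lef_pV2 ?posrE; lra. Qed.

Lemma next_ratio_decr d t : (0 < d)%N -> 0 <= t -> next_ratio t d.+1 <= next_ratio t d.
Proof. by move=> /digit_ge1 d1 t0; rewrite lef_pV2 ?posrE -?natr1; lra. Qed.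

Lemma digit_tail1 t : 0 <= t -> digit_tail t 1 = 1.
Proof. by move=> t0; rewrite /digit_tail divff //; lra. Qed.

Lemma digit_tail_ge0 t d : 0 <= t -> 0 <= digit_tail t d.
Proof. by move=> t0; rewrite divr_ge0 ?addr_ge0. Qed.

Lemma digit_tail_le t D : in01 t -> digit_tail t D.+1 <= 2 / D.+1%:R.
Proof.
move=> /andP[t0 t1]; have D1 : 1 <= D.+1%:R :> R by rewrite ler1n.
by rewrite ler_pM ?invr_ge0 ?addr_ge0 ?lef_pV2 ?posrE; lra.
Qed.

Lemma digit_tail_homo d t t' : (0 < d)%N -> 0 <= t -> t <= t' ->
  digit_tail t d <= digit_tail t' d.
Proof.
move=> /digit_ge1 d1 t0 tt; rewrite /digit_tail ler_pdivrMr; last lra.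
by rewrite mulrAC ler_pdivlMr; nra.
Qed.

Lemma digit_probE t d : (0 < d)%N -> 0 <= t ->
  digit_prob t d = (1 + t) / ((d%:R + t) * (d%:R + t + 1)).
Proof.
move=> /digit_ge1 d1 t0; rewrite /digit_prob /digit_tail -natr1; field.
by apply/andP; split; lra.
Qed.

Lemma digit_prob_ge0 t d : (0 < d)%N -> 0 <= t -> 0 <= digit_prob t d.
Proof. by move=> d0 t0; rewrite digit_probE // divr_ge0 ?mulr_ge0 ?addr_ge0. Qed.

Lemma digit_prob_le_capped D t d : (0 < d)%N -> 0 <= t ->
  0 <= digit_prob t d <= capped_prob D t d.
Proof.
move=> d0 t0; rewrite digit_prob_ge0 //= /capped_prob; case: ifP => // _.
by rewrite lerBlDr lerDl digit_tail_ge0.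
Qed.

Lemma sum_capped_prob D t (x : nat -> R) :
  \sum_(1 <= d < D.+2) capped_prob D.+1 t d * x d =
  \sum_(1 <= d < D.+1) digit_prob t d * x d + digit_tail t D.+1 * x D.+1.
Proof.
rewrite big_nat_recr //= /capped_prob ltnn; congr (_ + _).
by apply: eq_big_nat => d /andP[_ ->].
Qed.

(* Abel summation: [capped_prob D.+1] has the tails [digit_tail t d]. *)
Lemma sum_capped_prob_Abel D t (x : nat -> R) : 0 <= t ->
  \sum_(1 <= d < D.+2) capped_prob D.+1 t d * x d =
  x 1%N + \sum_(1 <= d < D.+1) digit_tail t d.+1 * (x d.+1 - x d).
Proof.
move=> t0; rewrite sum_capped_prob; elim: D => [|D IH].
  by rewrite !big_geq // digit_tail1 // mul1r add0r addr0.
by rewrite big_nat_recr //= [X in _ = _ + X]big_nat_recr //= addrA -IH /digit_prob; ring.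
Qed.

Lemma sum_capped_sub_digit_prob D t :
  \sum_(d <- digits D.+1) (capped_prob D.+1 t d - digit_prob t d) = digit_tail t D.+2.
Proof.
rewrite /digits big_nat_recr //= big_nat big1 ?add0r => [|d /andP[_ dD]].
  by rewrite /capped_prob ltnn subKr.
by rewrite /capped_prob dD subrr.
Qed.

Lemma capped_prob_stochastic D : (0 < D)%N ->
  stochastic next_ratio (capped_prob D) (digits D) in01.
Proof.
case: D => // D _; split.
- move=> t d /andP[t0 _]; rewrite mem_digits => /andP[d0 _].
  by have /andP[p0 pc] := digit_prob_le_capped D.+1 d0 t0; apply: le_trans pc.
- move=> t /andP[t0 _]; have := sum_capped_prob_Abel D (fun=> 1) t0.
  under eq_bigr do rewrite mulr1; move=> ->.
  by rewrite big1 ?addr0 // => d _; rewrite subrr mulr0.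
- by move=> t d t01; rewrite mem_digits => /andP[d0 _]; apply: next_ratio01.
Qed.

End DigitChain.

Local Notation digit_weight := (path_weight next_ratio digit_prob).
Local Notation digit_transfer D := (transfer next_ratio (capped_prob D) (digits D)).
Local Notation digit_expect D := (expect next_ratio (capped_prob D) (digits D)).

Section TransferContraction.
Context {R : realFieldType}.
Implicit Types (t : R) (F : R -> R) (d D n : nat).

(* Stochastic monotonicity: a larger ratio makes large digits likelier, and
   both effects decrease the next ratio. *)
Lemma digit_transfer_anti D F t t' : (0 < D)%N ->
  (forall a b, in01 a -> in01 b -> a <= b -> F a <= F b) ->
  in01 t -> in01 t' -> t <= t' -> digit_transfer D F t' <= digit_transfer D F t.
Proof.
case: D => // D D0 F_homo t01 t'01 tt.
have [/andP[t0 _] /andP[t'0 _]] := (t01, t'01).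
apply: (@le_trans _ _ (\sum_(d <- digits D.+1) capped_prob D.+1 t' d * F (next_ratio t d))).
  rewrite /transfer big_seq [leRHS]big_seq ler_sum // => d dD.
  rewrite ler_wpM2l ?(stochastic_ge0 (capped_prob_stochastic _)) //.
  move: dD; rewrite mem_digits => /andP[d0 _].
  by apply: F_homo; [exact: next_ratio01..|exact: next_ratio_anti].
rewrite /transfer !(sum_capped_prob_Abel _ (fun d => F (next_ratio t d))) // lerD2l.
apply: ler_sum_nat => d /andP[d0 _].
rewrite ler_wnM2r ?digit_tail_homo // subr_le0.
by apply: F_homo; [exact: next_ratio01..|exact: next_ratio_decr].
Qed.

(* A gauge whose transfer is a telescoping sum; lengths measured by it are halved. *)
Definition gauge t : R := t / (1 + 2 * t).

Lemma gauge_homo t t' : 0 <= t -> t <= t' -> gauge t <= gauge t'.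
Proof.
move=> t0 tt; rewrite /gauge ler_pdivrMr; last lra.
by rewrite mulrAC ler_pdivlMr; nra.
Qed.

Lemma digit_transfer_gauge D t : (0 < D)%N -> 0 <= t ->
  digit_transfer D gauge t =
  (2 * (2 + t))^-1 + (1 + t) / (2 * (D%:R + t + 1) * (D%:R + t + 2)).
Proof.
case: D => // D _ t0.
have gaugeV y : 1 <= y -> gauge y^-1 = (y + 2)^-1.
  by move=> y1; rewrite /gauge; field; apply/andP; split; lra.
have y1 d : (0 < d)%N -> 1 <= d%:R + t by move=> /(@digit_ge1 R); lra.
rewrite /transfer /digits sum_capped_prob gaugeV ?y1 //.
pose A d := - ((1 + t) / (2 * (d%:R + t) * (d%:R + t + 1))).
rewrite (@telescope_sumr_eq _ 1 D.+1 A) // => [|d /andP[d0 _]].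
  have := y1 D.+1 isT; rewrite /A /digit_tail.
  by move: (D.+1%:R) => y y0; field; do 3?(apply/andP; split); lra.
rewrite /A gaugeV ?y1 // digit_probE // -(natr1 d); have := y1 d d0.
by move: (d%:R) => y y0; field; do 2?(apply/andP; split); lra.
Qed.

Lemma digit_transfer_gauge_le D t t' : (1 < D)%N -> in01 t -> in01 t' -> t <= t' ->
  digit_transfer D gauge t - digit_transfer D gauge t' <= (gauge t' - gauge t) / 2.
Proof.
move=> D1 /andP[t0 t1] /andP[t'0 t'1] tt; rewrite !digit_transfer_gauge //; try lia.
have D2 : 2 <= D%:R :> R by rewrite ler_nat.
have cap_le : (1 + t) / (2 * (D%:R + t + 1) * (D%:R + t + 2)) <=
    (1 + t') / (2 * (D%:R + t' + 1) * (D%:R + t' + 2)).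
  move: (D%:R) D2 => y y2; rewrite ler_pdivrMr; last by rewrite !mulr_gt0; lra.
  rewrite mulrAC ler_pdivlMr; last by rewrite !mulr_gt0; lra.
  rewrite -subr_ge0.
  have -> : (1 + t') * (2 * (y + t + 1) * (y + t + 2)) - (1 + t) * (2 * (y + t' + 1) * (y + t' + 2))
    = 2 * (t' - t) * (y * (y + 1) - (1 + t) * (1 + t')) by ring.
  by rewrite !mulr_ge0 ?subr_ge0 //; nra.
have gauge_sub : (gauge t' - gauge t) / 2 = (t' - t) / (2 * ((1 + 2 * t) * (1 + 2 * t'))).
  by rewrite /gauge; field; apply/andP; split; lra.
have main_sub : (2 * (2 + t))^-1 - (2 * (2 + t'))^-1 = (t' - t) / (2 * ((2 + t) * (2 + t'))).
  by field; apply/andP; split; lra.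
have main_le : (t' - t) / (2 * ((2 + t) * (2 + t'))) <= (gauge t' - gauge t) / 2.
  rewrite gauge_sub ler_wpM2l ?subr_ge0 // lef_pV2 ?posrE ?mulr_gt0 //; try lra.
  by rewrite ler_pM2l // ler_pM; lra.
lra.
Qed.

Definition gauge_lipschitz (L : R) F : Prop :=
  forall t t', in01 t -> in01 t' -> t <= t' -> `|F t' - F t| <= L * (gauge t' - gauge t).

(* [L * gauge + F] and [L * gauge - F] are nondecreasing, so their transfers are
   nonincreasing, which bounds the variation of the transfer of [F] by that of [gauge]. *)
Lemma digit_transfer_lipschitz D L F : (1 < D)%N -> 0 <= L -> gauge_lipschitz L F ->
  gauge_lipschitz (L / 2) (digit_transfer D F).
Proof.
move=> D1 L0 LF t t' t01 t'01 tt.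
have signed_le (c : R) : c = 1 \/ c = -1 ->
    c * (digit_transfer D F t' - digit_transfer D F t) <= L / 2 * (gauge t' - gauge t).
  move=> c1; have homo a b : in01 a -> in01 b -> a <= b ->
      L * gauge a + c * F a <= L * gauge b + c * F b.
    move=> a01 b01 ab; have := LF a b a01 b01 ab; rewrite ler_norml => /andP[].
    by case: c1 => ->; lra.
  have lin y : digit_transfer D (fun a => L * gauge a + c * F a) y =
      L * digit_transfer D gauge y + c * digit_transfer D F y.
    by rewrite /transfer !big_distrr -big_split; apply: eq_bigr => d _ /=; ring.
  have := digit_transfer_anti (ltnW D1) homo t01 t'01 tt; rewrite !lin.
  by have := ler_wpM2l L0 (digit_transfer_gauge_le D1 t01 t'01 tt); lra.
have := signed_le 1 (or_introl erefl); have := signed_le (-1) (or_intror erefl).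
by rewrite ler_norml => ? ?; apply/andP; split; lra.
Qed.

Lemma iter_digit_transfer_lipschitz D L F n : (1 < D)%N -> 0 <= L -> gauge_lipschitz L F ->
  gauge_lipschitz (L / 2 ^+ n) (iter n (digit_transfer D) F).
Proof.
move=> D1 L0 LF; elim: n => [|n IH]; first by rewrite expr0 divr1.
rewrite iterS exprSr invfM mulrA; apply: digit_transfer_lipschitz => //.
by rewrite divr_ge0 ?exprn_ge0.
Qed.

End TransferContraction.

(** * Cylinders and convergence to the Gauss measure *)

Section Cylinders.
Context {R : realFieldType}.
Implicit Types (t x y : R) (D d n : nat) (s v w : seq nat).

Fixpoint cylinder_ends s : R * R :=
  if s is d :: s' then (next_ratio (cylinder_ends s').2 d, next_ratio (cylinder_ends s').1 d)
  else (0, 1).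

Lemma cylinder_ends_bounds s : pos_digits s ->
  [/\ 0 <= (cylinder_ends s).1, (cylinder_ends s).1 < (cylinder_ends s).2
    & (cylinder_ends s).2 <= 1].
Proof.
elim: s => [|d s IH] /=; first by split; lra.
move=> /andP[/(@digit_ge1 R) d1 /IH[lo0 lohi hi1]]; split.
- by rewrite invr_ge0 addr_ge0 //; lra.
- by rewrite ltf_pV2 ?posrE; lra.
- by rewrite invf_le1; lra.
Qed.

(* If the last two convergent denominators have ratio [t], the remainder is at most
   [x] with this probability. *)
Definition remainder_cdf t x : R := (1 + t) * x / (1 + t * x).

Lemma remainder_cdf_bounds t x y : 0 <= t -> 0 <= x -> x <= y -> y <= 1 ->
  [/\ 0 <= remainder_cdf t x, remainder_cdf t x <= remainder_cdf t y & remainder_cdf t y <= 1].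
Proof.
move=> t0 x0 xy y1.
have [tx0 ty0] : 0 <= t * x /\ 0 <= t * y by rewrite !mulr_ge0 //; lra.
split; first by rewrite divr_ge0 ?mulr_ge0; lra.
  rewrite ler_pdivrMr; last lra.
  by rewrite mulrAC ler_pdivlMr; nra.
by rewrite ler_pdivrMr; nra.
Qed.

Lemma remainder_cdf_variation t t' x : in01 t -> in01 t' -> t <= t' -> 0 <= x <= 1 ->
  0 <= remainder_cdf t' x - remainder_cdf t x <= 9 / 4 * (gauge t' - gauge t).
Proof.
move=> /andP[t0 t1] /andP[t'0 t'1] tt /andP[x0 x1].
have [tx0 t'x0] : 0 <= t * x /\ 0 <= t' * x by rewrite !mulr_ge0.
pose g := (1 + 2 * t) * (1 + 2 * t'); pose c := (1 + t * x) * (1 + t' * x).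
have g9 : 0 < g <= 9 by rewrite /g; nra.
have c1 : 1 <= c by rewrite /c; nra.
have -> : remainder_cdf t' x - remainder_cdf t x = (t' - t) * (x * (1 - x) / c).
  by rewrite /remainder_cdf /c; field; apply/andP; split; lra.
have -> : gauge t' - gauge t = (t' - t) / g.
  by rewrite /gauge /g; field; apply/andP; split; lra.
have x4 : 0 <= x * (1 - x) <= 1 / 4 by have := sqr_ge0 (x - 1 / 2); nra.
have xc : 0 <= x * (1 - x) / c <= 1 / 4.
  apply/andP; split; first by rewrite divr_ge0 //; lra.
  by rewrite ler_pdivrMr; nra.
have gV : 1 / 9 <= g^-1 by rewrite div1r lef_pV2 ?posrE; lra.
rewrite mulr_ge0 ?subr_ge0 //=; last lra.
by rewrite [leRHS]mulrCA ler_wpM2l ?subr_ge0 //; lra.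
Qed.

Lemma digit_weight_cdf t s : pos_digits s -> 0 <= t ->
  digit_weight t s =
  remainder_cdf t (cylinder_ends s).2 - remainder_cdf t (cylinder_ends s).1.
Proof.
elim: s t => [|d s IH] t /=.
  by move=> _ t0; rewrite /remainder_cdf mulr0 mul0r subr0 !mulr1 divff //; lra.
move=> /andP[d0 s0] t0; have d1 := @digit_ge1 R _ d0.
have [lo0 lohi hi1] := cylinder_ends_bounds s0.
have t1 : 0 < next_ratio t d by rewrite invr_gt0; lra.
rewrite IH ?(ltW t1) // digit_probE // /remainder_cdf /next_ratio.
move: (cylinder_ends s).1 (cylinder_ends s).2 lo0 lohi hi1 => a b a0 ab b1.
by field; do 5!(apply/andP; split; first by lra); lra.
Qed.

Lemma digit_weight01 t s : pos_digits s -> in01 t -> 0 <= digit_weight t s <= 1.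
Proof.
move=> s0 /andP[t0 _]; have [lo0 lohi hi1] := cylinder_ends_bounds s0.
rewrite digit_weight_cdf //.
by have [] := remainder_cdf_bounds t0 lo0 (ltW lohi) hi1; lra.
Qed.

Lemma digit_weight_lipschitz s : pos_digits s -> gauge_lipschitz (9 / 4 : R) (digit_weight ^~ s).
Proof.
move=> s0 t t' t01 t'01 tt; have [/andP[t0 _] /andP[t'0 _]] := (t01, t'01).
have [lo0 lohi hi1] := cylinder_ends_bounds s0; rewrite !digit_weight_cdf //.
have lo01 : 0 <= (cylinder_ends s).1 <= 1 by lra.
have hi01 : 0 <= (cylinder_ends s).2 <= 1 by lra.
have /andP[? ?] := remainder_cdf_variation t01 t'01 tt lo01.
have /andP[? ?] := remainder_cdf_variation t01 t'01 tt hi01.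
by rewrite ler_norml; apply/andP; split; lra.
Qed.

Lemma iter_digit_transfer_oscillation D n s t t' : (1 < D)%N -> pos_digits s ->
  in01 t -> in01 t' ->
  `|iter n (digit_transfer D) (digit_weight ^~ s) t
    - iter n (digit_transfer D) (digit_weight ^~ s) t'| <= (2 ^+ n)^-1.
Proof.
move=> D1 s0; wlog tt : t t' / t' <= t => [wlg t01 t'01|t01 t'01].
  by have [/wlg|/ltW /wlg] := leP t' t; last rewrite distrC; apply.
apply: le_trans (iter_digit_transfer_lipschitz n D1 _ (digit_weight_lipschitz s0) t'01 t01 tt) _.
  lra.
have /andP[t'0 _] := t'01; have /andP[t0 t1] := t01.
have : 0 <= gauge t' by rewrite divr_ge0 //; lra.
have : gauge t <= 1 / 3.
  by apply: le_trans (gauge_homo t0 t1) _; rewrite /gauge mulr1 (_ : 1 + 2 = 3) //; ring.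
move=> g1 g0; rewrite mulrAC ler_piMl ?invr_ge0 ?exprn_ge0 //; lra.
Qed.

Lemma expect_digit_weight_bounds D n t s : (0 < D)%N -> in01 t -> pos_digits s ->
  0 <= iter n (digit_transfer D) (digit_weight ^~ s) t
       - \sum_(w <- words (digits D) n) digit_weight t (w ++ s) <= n%:R * (2 / D.+1%:R).
Proof.
move=> D0 t01 s0; have chain := @capped_prob_stochastic R D D0.
rewrite iter_transfer; under eq_bigr do rewrite path_weight_cat.
apply: (expect_sub_le chain) => //.
- by move=> y d /andP[y0 _]; rewrite mem_digits => /andP[d0 _]; apply: digit_prob_le_capped.
- move=> y y01; case: D D0 {chain} => // D _; rewrite sum_capped_sub_digit_prob.
  exact: digit_tail_le.
- move=> u ud; apply: digit_weight01 => //; apply: (stochastic_run chain) => //.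
  by move: ud; rewrite mem_words => /andP[].
Qed.

Lemma cylinder_ends_cat v w : pos_digits v -> pos_digits w -> (1 < size w)%N ->
  (cylinder_ends v).1 < (cylinder_ends (v ++ w)).1 /\
  (cylinder_ends (v ++ w)).2 < (cylinder_ends v).2.
Proof.
move=> + w0 w2; elim: v => [_|d v IH /andP[d0 v0]] /=.
  case: w w0 w2 => [|d [|e w]] //= /and3P[d0 e0 w0] _.
  have [lo0 lohi hi1] := cylinder_ends_bounds w0.
  have [/(@digit_ge1 R) d1 /(@digit_ge1 R) e1] := (d0, e0).
  have n0 x : 0 <= x -> 0 < next_ratio x e by move=> x0; rewrite invr_gt0; lra.
  have [? ?] := (n0 _ lo0, n0 _ (ltW (le_lt_trans lo0 lohi))).
  by split; [rewrite invr_gt0|rewrite invf_lt1]; lra.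
have d1 := @digit_ge1 R _ d0; have [? ?] := IH v0.
have [? ? ?] := cylinder_ends_bounds v0.
have vw0 : pos_digits (v ++ w) by rewrite pos_digits_cat; apply/andP.
have [? ? ?] := cylinder_ends_bounds vw0.
by split; rewrite ltf_pV2 ?posrE; lra.
Qed.

End Cylinders.

Lemma is_derive_sum_seq (R : numFieldType) (V W : normedModType R) (I : eqType) (r : seq I)
    (h : I -> V -> W) (dh : I -> W) (x v : V) :
  (forall i, i \in r -> is_derive x v (h i) (dh i)) ->
  is_derive x v (fun u => \sum_(i <- r) h i u) (\sum_(i <- r) dh i).
Proof.
elim: r => [|i r IH] dr.
  by under eq_fun do rewrite big_nil; rewrite big_nil; exact: is_derive_cst.
under eq_fun do rewrite big_cons; rewrite big_cons; apply: is_deriveD.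
  by apply: dr; rewrite mem_head.
by apply: IH => j jr; apply: dr; rewrite in_cons jr orbT.
Qed.

Section GaussProbability.
Context {R : realType}.
Implicit Types (t x y : R) (D d n : nat) (s w : seq nat).

Definition gauss_prob s : R :=
  (ln (1 + (cylinder_ends s).2) - ln (1 + (cylinder_ends s).1)) / ln 2.

Lemma ln2_gt0 : 0 < ln 2 :> R.
Proof. by apply: ln_gt0; lra. Qed.

Lemma lnB_le x y : 0 < x -> 0 < y -> ln y - ln x <= (y - x) / x.
Proof.
move=> x0 y0; rewrite -ln_div ?posrE //.
have -> : y / x = 1 + (y - x) / x by field; lra.
apply: le_ln1Dx; rewrite ltr_pdivlMr //; lra.
Qed.

Lemma is_derive_ln1M (b t : R) : 0 < 1 + t * b ->
  is_derive t 1 (fun u => ln (1 + u * b)) (b / (1 + t * b)).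
Proof.
move=> tb; have affine : is_derive t 1 (fun u : R => 1 + u * b) b.
  refine (is_derive_eq (is_deriveD (is_derive_cst (1 : R) t 1)
    (is_deriveM (is_derive_id t 1) (is_derive_cst b t 1))) _).
  by rewrite /= scaler0 !add0r /GRing.scale /= mulr1.
refine (is_derive_eq (@is_derive1_comp R (@ln R) (fun u => 1 + u * b) t _ _
  (is_derive1_ln tb) affine) _).
by rewrite mulrC.
Qed.

(* [ln 2 * gauss_prob w] is the integral of [digit_weight t w / (1 + t)] over [0, 1]. *)
Lemma gauss_prob_mean_value (r : seq (seq nat)) : all pos_digits r ->
  exists2 t, in01 t & \sum_(w <- r) gauss_prob w = \sum_(w <- r) digit_weight t w.
Proof.
move=> /allP r0; set M := \sum_(w <- r) gauss_prob w.
pose h w t : R := ln (1 + t * (cylinder_ends w).2) - ln (1 + t * (cylinder_ends w).1).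
pose dh w t : R := (cylinder_ends w).2 / (1 + t * (cylinder_ends w).2)
  - (cylinder_ends w).1 / (1 + t * (cylinder_ends w).1).
pose Phi t : R := \sum_(w <- r) h w t - ln (1 + t * 1) * M.
pose dPhi t : R := \sum_(w <- r) dh w t - 1 / (1 + t * 1) * M.
have der_Phi t : in01 t -> is_derive t 1 Phi (dPhi t).
  move=> /andP[t0 t1]; apply: is_deriveB.
    apply: is_derive_sum_seq => w /r0 w0; have [? ? ?] := @cylinder_ends_bounds R w w0.
    by apply: is_deriveB; apply: is_derive_ln1M; nra.
  have t1' : 0 < 1 + t * 1 by lra.
  refine (is_derive_eq (is_deriveM (is_derive_ln1M t1') (is_derive_cst _ _ _)) _).
  by rewrite scaler0 add0r /GRing.scale /= mulrC.
have Phi0 : Phi 0 = 0.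
  rewrite /Phi mul0r addr0 ln1 mul0r subr0 big1 // => w _.
  by rewrite /h !mul0r addr0 subrr.
have Phi1 : Phi 1 = 0.
  rewrite /Phi mul1r /M big_distrr -sumrB big1 //= => w _.
  by rewrite /h /gauss_prob !mul1r mulrCA mulfV ?mulr1 ?subrr // lt0r_neq0 // ln2_gt0.
have [||t t01 dt] := @Rolle R Phi 0 1 ltr01 _ _ (etrans Phi0 (esym Phi1)).
- move=> t; rewrite in_itv /= => /andP[t0 t1].
  by have [] : is_derive t 1 Phi (dPhi t) by apply: der_Phi; rewrite /in01 !ltW.
- apply: derivable_within_continuous => t; rewrite in_itv /= => t01.
  by have [] := der_Phi t t01.
have {}t01 : in01 t by move: t01; rewrite in_itv /= /in01 => /andP[/ltW -> /ltW ->].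
exists t => //; have : dPhi t = 0 by case: (der_Phi t t01) => _ <-; case: dt.
have /andP[t0 t1] := t01.
have weightE w : w \in r -> digit_weight t w = (1 + t) * dh w t.
  move=> /r0 w0; have [? ? ?] := @cylinder_ends_bounds R w w0.
  by rewrite digit_weight_cdf // mulrBr !mulrA.
rewrite (eq_big_seq _ weightE) -big_distrr /= /dPhi => /eqP; rewrite subr_eq0 => /eqP ->.
by field; lra.
Qed.

Lemma gauss_prob01 s : pos_digits s -> 0 <= gauss_prob s <= 1.
Proof.
move=> s0; have [|t t01] := @gauss_prob_mean_value [:: s]; first by rewrite /= s0.
by rewrite !big_seq1 => ->; apply: digit_weight01.
Qed.

Lemma sum_gauss_prob_cons D s : pos_digits s ->
  \sum_(d <- digits D) gauss_prob (d :: s) = gauss_prob s -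
    (ln (D.+1%:R + (cylinder_ends s).2) - ln (D.+1%:R + (cylinder_ends s).1)) / ln 2.
Proof.
move=> s0; have [lo0 lohi hi1] := @cylinder_ends_bounds R s s0.
have lnE d x : 0 <= x -> (0 < d)%N -> ln (1 + (d%:R + x)^-1) = ln (d.+1%:R + x) - ln (d%:R + x).
  move=> x0 /(@digit_ge1 R) d1; rewrite -ln_div ?posrE; [|rewrite -natr1; lra|lra].
  by congr ln; rewrite -(natr1 d); field; lra.
pose A d : R := - ((ln (d%:R + (cylinder_ends s).2) - ln (d%:R + (cylinder_ends s).1)) / ln 2).
rewrite /digits (@telescope_sumr_eq _ 1 D.+1 A) => [|//|d /andP[d0 _]].
  by rewrite /A opprK addrC.
by rewrite /gauss_prob /= /next_ratio !lnE //; [rewrite /A; ring|lra].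
Qed.

Lemma sum_gauss_prob_cons_bounds D s : pos_digits s ->
  (1 - 2 / D.+1%:R) * gauss_prob s <= \sum_(d <- digits D) gauss_prob (d :: s) <= gauss_prob s.
Proof.
move=> s0; have [lo0 lohi hi1] := @cylinder_ends_bounds R s s0; rewrite sum_gauss_prob_cons //.
have l2 := ln2_gt0; have D1 := @digit_ge1 R D.+1 isT.
rewrite /gauss_prob; set a := (cylinder_ends s).1 in lo0 lohi *.
set b := (cylinder_ends s).2 in lohi hi1 *.
have rem_ge0 : 0 <= ln (D.+1%:R + b) - ln (D.+1%:R + a) by rewrite subr_ge0 ler_ln ?posrE; lra.
have rem_le : ln (D.+1%:R + b) - ln (D.+1%:R + a) <= (b - a) / D.+1%:R.
  apply: le_trans (lnB_le _ _) _; try lra.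
  by rewrite opprD addrACA subrr add0r ler_wpM2l ?subr_ge0 ?(ltW lohi) // lef_pV2 ?posrE; lra.
have main_ge : (b - a) / 2 <= ln (1 + b) - ln (1 + a).
  have lnBA : ln (1 + a) - ln (1 + b) <= (a - b) / (1 + b).
    by rewrite -[a - b](addrKA 1) [a + 1]addrC; apply: lnB_le; lra.
  have : (b - a) / 2 <= (b - a) / (1 + b).
    by rewrite ler_wpM2l ?subr_ge0 ?(ltW lohi) // lef_pV2 ?posrE; lra.
  by move: lnBA; rewrite -[a - b]opprB mulNr; lra.
apply/andP; split; last by rewrite gerBl divr_ge0 // ltW.
rewrite mulrBl mul1r lerD2l lerN2 mulrA ler_wpM2r ?invr_ge0 ?(ltW l2) //.
apply: le_trans rem_le _.
have -> : (b - a) / D.+1%:R = 2 / D.+1%:R * ((b - a) / 2) by field; lra.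
by rewrite ler_wpM2l // divr_ge0 //; lra.
Qed.

Lemma sum_gauss_prob_cat_bounds D n s : (0 < D)%N -> pos_digits s ->
  (1 - n%:R * (2 / D.+1%:R)) * gauss_prob s
    <= \sum_(w <- words (digits D) n) gauss_prob (w ++ s) <= gauss_prob s.
Proof.
move=> D0 s0; have /andP[g0 _] := gauss_prob01 s0; elim: n => [|n IH].
  by rewrite big_seq1 /= mul0r subr0 mul1r lexx.
set e := 2 / D.+1%:R in IH *; set S := \sum_(w <- _) _ in IH.
have e0 : 0 <= e by rewrite divr_ge0.
have e1 : e <= 1 by rewrite ler_pdivrMr ?ltr0n // mul1r ler_nat.
have -> : \sum_(w <- words (digits D) n.+1) gauss_prob (w ++ s) =
    \sum_(w <- words (digits D) n) \sum_(d <- digits D) gauss_prob (d :: (w ++ s)).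
  by rewrite /= big_allpairs_dep /= exchange_big.
set S' := \sum_(w <- _) _.
have consP w : w \in words (digits D) n -> (1 - e) * gauss_prob (w ++ s) <=
    \sum_(d <- digits D) gauss_prob (d :: (w ++ s)) <= gauss_prob (w ++ s).
  move=> /words_pos_digits w0; apply: sum_gauss_prob_cons_bounds.
  by rewrite pos_digits_cat w0.
have S'S : S' <= S by rewrite /S' /S big_seq [leRHS]big_seq ler_sum // => w /consP/andP[].
have SS' : (1 - e) * S <= S'.
  by rewrite /S' /S big_distrr big_seq [leRHS]big_seq ler_sum // => w /consP/andP[].
have : 0 <= n%:R * e * e * gauss_prob s by do 3!apply: mulr_ge0 => //.
by rewrite -natr1; case/andP: IH; nra.
Qed.

(* The two averages over the first [n] digits, started from [t] and from the
   Gauss measure, are compared at a mean value of the latter. *)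
Lemma iter_digit_transfer_cvg D n t s : (1 < D)%N -> in01 t -> pos_digits s ->
  `|iter n (digit_transfer D) (digit_weight ^~ s) t - gauss_prob s| <=
  (2 ^+ n)^-1 + n%:R * (2 / D.+1%:R).
Proof.
move=> D1 t01 s0; set e := n%:R * _; set G := iter n _ _; have D0 := ltnW D1.
have /allP/gauss_prob_mean_value[t' t'01] :
    forall w, w \in [seq w ++ s | w <- words (digits D) n] -> pos_digits w.
  by move=> _ /mapP[w /words_pos_digits w0 ->]; rewrite pos_digits_cat w0.
rewrite !big_map => mean.
have /andP[d0 de] := expect_digit_weight_bounds n D0 t'01 s0.
have /andP[ge gle] := sum_gauss_prob_cat_bounds n D0 s0.
have := iter_digit_transfer_oscillation n D1 s0 t01 t'01.
rewrite -/G -/e in d0 de ge *; rewrite mean in ge gle.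
have /andP[g0 g1] := gauss_prob01 s0.
have eg : e * gauss_prob s <= e by rewrite ler_piMr // mulr_ge0 ?divr_ge0.
by rewrite !ler_norml => /andP[? ?]; apply/andP; split; lra.
Qed.

End GaussProbability.

(** * Frequency of a word in a random digit sequence *)

Section Discrepancy.
Context {R : realType}.
Variable s : seq nat.
Hypothesis s_gt0 : (0 < size s)%N.
Hypothesis s_pos : pos_digits s.
Implicit Types (t eps : R) (D k n : nat) (u v w : seq nat).

Definition discrepancy w : R := (occ s w)%:R - gauss_prob s * (size w)%:R.

Definition abnormal eps w : bool := eps * (size w)%:R < `|discrepancy w|.

Definition prefix_dev u : R := (prefix s u)%:R - gauss_prob s.

Lemma prefix_dev_le1 u : `|prefix_dev u| <= 1.
Proof.
have /andP[g0 g1] := @gauss_prob01 R s s_pos.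
by rewrite ler_norml /prefix_dev; case: (prefix s u) => /=; apply/andP; split; lra.
Qed.

Lemma prefix_dev_cat u v : (size s <= size u)%N -> prefix_dev (u ++ v) = prefix_dev u.
Proof. by move=> su; rewrite /prefix_dev prefix_cat_le. Qed.

Lemma discrepancyE w : discrepancy w = suffix_sum prefix_dev w.
Proof.
elim: w => [|d w IH]; first by rewrite /discrepancy /= mulr0 subr0.
rewrite [RHS]/= -IH /discrepancy /prefix_dev occ_cons natrD /= -[in LHS]natr1; ring.
Qed.

Lemma discrepancy_le_size w : `|discrepancy w| <= (size w)%:R.
Proof. by rewrite discrepancyE; apply/suffix_sum_le_size/prefix_dev_le1. Qed.

Lemma discrepancy_cat v u :
  `|discrepancy (v ++ u) - (discrepancy v + discrepancy u)| <= (size s)%:R.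
Proof.
have /andP[lower upper] := occ_cat s v u.
have {upper} : (occ s (v ++ u) <= occ s v + occ s u + size s)%N.
  by apply: leq_trans upper _; rewrite leq_add2l geq_minr.
move: lower; rewrite -!(ler_nat R) !natrD /discrepancy size_cat natrD => lower upper.
by rewrite ler_norml; apply/andP; split; lra.
Qed.

Lemma discrepancy_catr v u : `|discrepancy (v ++ u) - discrepancy v| <= (size u)%:R.
Proof.
have /andP[g0 g1] := @gauss_prob01 R s s_pos.
have /andP[] := occ_cat_bounds v u s_gt0; rewrite -!(ler_nat R) natrD => lower upper.
have : 0 <= (gauss_prob s : R) * (size u)%:R <= (size u)%:R by rewrite mulr_ge0 ?ler_piMl.
rewrite /discrepancy size_cat natrD => /andP[? ?].
by rewrite ler_norml; apply/andP; split; lra.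
Qed.

Lemma abnormal_take eps n w : 0 < eps ->
  (size w - n)%:R <= eps / 2 * (size w)%:R -> abnormal eps w -> abnormal (eps / 2) (take n w).
Proof.
rewrite /abnormal => e0 drop_le w_abn.
have := discrepancy_catr (take n w) (drop n w); rewrite cat_take_drop size_drop => take_close.
have : eps / 2 * (size (take n w))%:R <= eps / 2 * (size w)%:R.
  by rewrite ler_pM2l ?divr_gt0 // ler_nat size_take_min geq_minr.
by have := lerB_dist (discrepancy w) (discrepancy (take n w)); lra.
Qed.

Section CappedChain.
Variable D : nat.
Hypothesis s_lt : all (fun d => d < D)%N s.

Local Notation E := (digit_expect D).

Lemma path_weight_capped w t : all (fun d => d < D)%N w ->
  path_weight next_ratio (@capped_prob R D) t w = digit_weight t w.
Proof.
by elim: w t => //= d w IH t /andP[dD wD]; rewrite IH // /capped_prob dD.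
Qed.

Hypothesis D_gt1 : (1 < D)%N.

Let chain : stochastic next_ratio (@capped_prob R D) (digits D) in01.
Proof. exact/capped_prob_stochastic/ltnW. Qed.

Lemma expect_prefix_dev k t : (size s <= k)%N -> in01 t ->
  E k t prefix_dev = digit_weight t s - gauss_prob s.
Proof.
move=> sk t01; rewrite [LHS](expectD _ _ _ _ _ _ (fun=> - gauss_prob s)) (expect_cst chain) //.
rewrite (expect_prefix chain) ?path_weight_capped ?iota_uniq // all_digits s_pos.
by apply: sub_all s_lt => d /ltnW.
Qed.

Lemma expect_discrepancy_bound k t : (k ^ 2 <= D)%N -> in01 t ->
  `|E k t discrepancy| <= (size s)%:R + 3.
Proof.
move=> kD t01; under eq_expect => u _ do rewrite discrepancyE.
apply: le_trans (suffix_sum_mean_bound chain (size s) prefix_dev_le1 k t01) _.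
rewrite addrC lerD2l; set n := (k - size s)%N.
apply: (@le_trans _ _ (\sum_(0 <= i < n) ((2 ^+ i)^-1 + i%:R * (2 / D.+1%:R)))).
  apply: ler_sum_nat => i /andP[_ ilt].
  suff -> : E i t (fun v => E (k - i) (foldl next_ratio t v) prefix_dev) =
      iter i (digit_transfer D) (digit_weight ^~ s) t
      - gauss_prob s by apply: iter_digit_transfer_cvg.
  rewrite iter_transfer -[gauss_prob s in RHS](expect_cst chain i _ t01) -mulN1r -expectZ -expectD.
  apply: eq_expect => v; rewrite mem_words => /andP[_ vA].
  by rewrite mulN1r expect_prefix_dev //; [lia|apply: (stochastic_run chain)].
rewrite big_split /=.
have geometric m : \sum_(0 <= i < m) (2 ^+ i)^-1 = 2 - 2 / 2 ^+ m :> R.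
  elim: m => [|m IH]; first by rewrite big_geq // divr1 subrr.
  by rewrite big_nat_recr //= IH exprS; field; rewrite expf_neq0.
have triangular : \sum_(0 <= i < n) i%:R * (2 / D.+1%:R) <= 1 :> R.
  rewrite -big_distrl -natr_sum /= mulrA ler_pdivrMr ?ltr0n // mul1r -natrM ler_nat.
  rewrite bin2_sum bin2 muln2; have : (n * n.-1 <= k ^ 2)%N by rewrite leq_mul; lia.
  by have := odd_double_half (n * n.-1); lia.
have : 0 <= 2 / 2 ^+ n :> R by rewrite divr_ge0 ?exprn_ge0.
by have := geometric n; lra.
Qed.

Lemma expect_discrepancy_sq k t : (k ^ 2 <= D)%N -> in01 t ->
  E k t (fun u => discrepancy u ^+ 2) <= k%:R * (4 * (size s)%:R + 7).
Proof.
move=> kD t01; under eq_expect => u _ do rewrite discrepancyE.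
have mean j x : (j <= k)%N -> in01 x -> `|E j x (suffix_sum prefix_dev)| <= (size s)%:R + 3.
  move=> jk x01; under eq_expect => u _ do rewrite -discrepancyE.
  by apply: expect_discrepancy_bound => //; apply: leq_trans kD; rewrite leq_exp2r.
have := suffix_sum_variance_bound chain prefix_dev_le1 prefix_dev_cat mean s_gt0 (leqnn k) t01.
by move=> /le_trans; apply; rewrite ler_wpM2l //; lra.
Qed.

Lemma expect_abnormal_le k t eps : (0 < k)%N -> (k ^ 2 <= D)%N -> in01 t -> 0 < eps ->
  E k t (fun u => (abnormal eps u)%:R) <= (4 * (size s)%:R + 7) / (eps ^+ 2 * k%:R).
Proof.
move=> k0 kD t01 e0; have k0R : 0 < k%:R :> R by rewrite ltr0n.
rewrite (@eq_expect _ _ _ _ _ _ _ _ _ (fun u => (eps * k%:R < `|discrepancy u|)%R%:R)); last first.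
  by move=> u /size_words <-.
apply: le_trans (expect_chebyshev chain k discrepancy t01 (mulr_gt0 e0 k0R)) _.
have -> : (4 * (size s)%:R + 7) / (eps ^+ 2 * k%:R) =
    k%:R * (4 * (size s)%:R + 7) / (eps * k%:R) ^+ 2.
  by field; apply/andP; split; lra.
by rewrite ler_wpM2r ?invr_ge0 ?exprn_ge0 ?mulr_ge0 ?(ltW e0) // expect_discrepancy_sq.
Qed.

End CappedChain.
End Discrepancy.

(** * Continuants *)

(* The numerator and the denominator of the fraction with the given digits. *)
Fixpoint cf_frac (w : seq nat) : nat * nat :=
  if w is a :: w' then ((cf_frac w').2, (a * (cf_frac w').2 + (cf_frac w').1)%N) else (0, 1)%N.

Definition continuant w := (cf_frac w).2.

Definition next_dens (x : nat * nat) (a : nat) : nat * nat := (x.2, (a * x.2 + x.1)%N).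

(* The denominators of the last two convergents, the last one second. *)
Definition last_dens (w : seq nat) : nat * nat := foldl next_dens (0, 1)%N w.

Lemma cf_frac_cat v w w' : cf_frac w = cf_frac w' -> cf_frac (v ++ w) = cf_frac (v ++ w').
Proof. by move=> ww'; elim: v => //= a v ->. Qed.

Lemma foldl_next_dens x w :
  (foldl next_dens x w).2 = (x.2 * continuant w + x.1 * (cf_frac w).1)%N.
Proof.
elim: w x => [|a w IH] [x' x] /=; first by rewrite /continuant /= muln1 muln0 addn0.
by rewrite IH /continuant /=; ring.
Qed.

Lemma last_dens_continuant w : (last_dens w).2 = continuant w.
Proof. by rewrite /last_dens foldl_next_dens mul1n mul0n addn0. Qed.

Lemma last_dens_le w : pos_digits w -> ((last_dens w).1 <= continuant w)%N.
Proof.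
rewrite -last_dens_continuant /last_dens; have : (0 <= 1)%N by [].
elim: w (0%N) (1%N) => //= a w IH x' x xx /andP[a0 w0].
by apply: IH => //=; nia.
Qed.

Lemma continuant_gt0 w : pos_digits w -> (0 < continuant w)%N.
Proof. by elim: w => //= a w IH /andP[a0 /IH]; rewrite /continuant /=; lia. Qed.

Lemma continuant_cons_ge a w : (a * continuant w <= continuant (a :: w))%N.
Proof. by rewrite /continuant /= leq_addr. Qed.

Lemma digit_le_continuant w d : pos_digits w -> d \in w -> (d <= continuant w)%N.
Proof.
elim: w => //= a w IH /andP[a0 w0].
have := continuant_gt0 w0; have := continuant_cons_ge a w.
by rewrite in_cons => ? ? /orP[/eqP ->|/(IH w0) ?]; nia.
Qed.

Lemma expn2_half_le_continuant w : pos_digits w -> (2 ^ (size w)./2 <= continuant w)%N.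
Proof.
elim: {w}(size w).+1 {-2}w (ltnSn (size w)) => // n IH [|a [|b w]] //= sz.
  by rewrite andbT expn0 /continuant /= muln1 addn0.
move=> /and3P[a0 b0 w0]; have {}IH : (2 ^ (size w)./2 <= continuant w)%N by apply: IH => //; lia.
rewrite expnS (@leq_trans (2 * continuant w)) ?leq_mul2l //.
rewrite /continuant /=; case: (cf_frac w) => x' x /=.
by have := leq_pmull x b0; have := leq_pmull (b * x + x') a0; lia.
Qed.

Lemma all_digits_continuant w D : pos_digits w -> (continuant w <= D)%N -> all [in digits D] w.
Proof.
move=> w0 wD; rewrite all_digits w0; apply/allP => d dw.
by apply: leq_trans wD; apply: digit_le_continuant.
Qed.

Lemma sum_continuant_take_sq u : pos_digits u ->
  (\sum_(0 <= j < (size u).+1) continuant (take j u) ^ 2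
     <= continuant u * (continuant u + (last_dens u).1))%N.
Proof.
elim/last_ind: u => [|u a IH]; first by rewrite big_nat1.
rewrite /pos_digits all_rcons => /andP[a0 u0]; rewrite size_rcons big_nat_recr //=.
rewrite -(size_rcons u a) take_size -!last_dens_continuant.
have -> : (\sum_(0 <= j < size (rcons u a)) continuant (take j (rcons u a)) ^ 2 =
    \sum_(0 <= j < (size u).+1) continuant (take j u) ^ 2)%N.
  rewrite size_rcons; apply: eq_big_nat => j /andP[_ ju].
  by rewrite -cats1 takel_cat //; lia.
move: (IH u0); rewrite -last_dens_continuant /last_dens foldl_rcons -/(last_dens u) /next_dens.
by case: (last_dens u) => x' x /=; nia.
Qed.

Lemma sum_continuant_take_le u m : pos_digits u ->
  (\sum_(0 <= j < (size u).+1 | continuant (take j u) <= m) continuant (take j u) ^ 2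
     <= 2 * m ^ 2)%N.
Proof.
elim/last_ind: u => [|u a IH] ua0.
  by rewrite big_mkcond big_nat1 /continuant /=; case: ifP => //; nia.
have [am|ma] := leqP (continuant (rcons u a)) m.
  apply: (@leq_trans (\sum_(0 <= j < (size (rcons u a)).+1) continuant (take j (rcons u a)) ^ 2)).
    by rewrite [leqRHS](bigID (fun j => continuant (take j (rcons u a)) <= m)%N) leq_addr.
  by apply: leq_trans (sum_continuant_take_sq ua0) _; have := last_dens_le ua0; nia.
move: ua0; rewrite /pos_digits all_rcons => /andP[_ u0].
rewrite size_rcons big_mkcond big_nat_recr //= -{2 3}(size_rcons u a) take_size.
rewrite [(continuant (rcons u a) <= m)%N]leqNgt ma addn0; apply: leq_trans (IH u0).
rewrite [leqRHS]big_mkcond; apply/eq_leq/eq_big_nat => j /andP[_ ju].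
by rewrite -cats1 takel_cat //; lia.
Qed.

Lemma sum_continuant_prefix_le (B : seq (seq nat)) u m : uniq B -> pos_digits u ->
  (forall w, w \in B -> continuant w <= m)%N ->
  (\sum_(w <- B | prefix w u) continuant w ^ 2 <= 2 * m ^ 2)%N.
Proof.
move=> uB u0 Bm; apply: leq_trans (sum_continuant_take_le m u0).
rewrite -big_filter -[leqRHS]big_filter.
rewrite -(big_map (fun j => take j u) xpredT (fun w => continuant w ^ 2)%N).
apply: (@uniq_sub_le_big _ addn leq leqnn (fun x y => leq_addr y x)); rewrite ?filter_uniq //.
- rewrite map_inj_in_uniq ?filter_uniq ?iota_uniq // => i j.
  rewrite !mem_filter !mem_index_iota => /andP[_ iu] /andP[_ ju] /(congr1 size).
  by rewrite !size_takel //; lia.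
- move=> w; rewrite mem_filter => /andP[wu wB]; apply/mapP; exists (size w).
    have := size_prefix wu; move: wu; rewrite prefixE mem_filter mem_index_iota => /eqP ->.
    by rewrite Bm.
  by move: wu; rewrite prefixE => /eqP.
Qed.

Section ContinuantWeight.
Context {R : realFieldType}.

Lemma digit_weight_next_dens x' x w : (0 < x)%N -> pos_digits w ->
  let q := foldl next_dens (x', x) w in
  digit_weight (x'%:R / x%:R : R) w = x%:R * (x%:R + x'%:R) / (q.2%:R * (q.2%:R + q.1%:R)).
Proof.
elim: w x' x => [|a w IH] x' x x0 /=.
  have : 0 < x%:R :> R by rewrite ltr0n.
  have : 0 <= x'%:R :> R by [].
  by move=> ? ? _; rewrite divff // mulf_neq0; lra.
move=> /andP[a0 w0].
have X0 : 0 < x%:R :> R by rewrite ltr0n.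
have X'0 : 0 <= x'%:R :> R by [].
have A0 := @digit_ge1 R _ a0.
have Q0 : 0 < a%:R * x%:R + x'%:R :> R by nra.
rewrite digit_probE ?divr_ge0 //.
have -> : next_ratio (x'%:R / x%:R) a = x%:R / (a * x + x')%N%:R :> R.
  by rewrite /next_ratio natrD natrM; field; apply/andP; split; lra.
rewrite IH //; last by nia.
set q := foldl _ _ _; have [qq|qq] := eqVneq (q.2%:R * (q.2%:R + q.1%:R) : R) 0.
  by rewrite qq invr0 !mulr0.
rewrite natrD natrM !mulrA; congr (_ / _).
by field; repeat (apply/andP; split); nra.
Qed.

Lemma digit_weight0_ge w : pos_digits w ->
  (2 * (continuant w)%:R ^+ 2)^-1 <= digit_weight (0 : R) w.
Proof.
move=> w0; have := digit_weight_next_dens 0 (isT : (0 < 1)%N) w0.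
rewrite /= mul0r addr0 !mul1r -/(last_dens w) last_dens_continuant => ->.
have := last_dens_le w0; have := continuant_gt0 w0.
rewrite -(ltr0n R) -(ler_nat R) => q0 qq; have := ler0n R (last_dens w).1 => q'0.
by rewrite lef_pV2 ?posrE; nra.
Qed.

End ContinuantWeight.

(** * Counting words with bounded continuant *)

Section ShortWords.
Context {R : rcfType}.
Implicit Types (k m D : nat) (w : seq nat).

Definition pow32 n : R := n%:R * Num.sqrt n%:R.

Lemma pow32_ge0 n : 0 <= pow32 n.
Proof. by rewrite mulr_ge0 ?sqrtr_ge0. Qed.

Lemma pow32_gt0 n : (0 < n)%N -> 0 < pow32 n.
Proof. by move=> n0; rewrite mulr_gt0 ?sqrtr_gt0 ?ltr0n. Qed.

Lemma pow32M n n' : pow32 (n * n') = pow32 n * pow32 n'.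
Proof. by rewrite /pow32 natrM sqrtrM // mulrACA. Qed.

Lemma ler_pow32 n n' : (n <= n')%N -> pow32 n <= pow32 n'.
Proof. by move=> nn'; rewrite ler_pM ?sqrtr_ge0 ?ler_wsqrtr ?ler_nat. Qed.

Lemma invr_pow32_le n : (0 < n)%N ->
  (pow32 n.+1)^-1 <= 2 / Num.sqrt n%:R - 2 / Num.sqrt n.+1%:R.
Proof.
move=> n0; have x0 : 0 < Num.sqrt n%:R :> R by rewrite sqrtr_gt0 ltr0n.
have y0 : 0 < Num.sqrt n.+1%:R :> R by rewrite sqrtr_gt0 ltr0n.
have xx : Num.sqrt n%:R ^+ 2 = n%:R :> R by rewrite sqr_sqrtr.
have yy : Num.sqrt n.+1%:R ^+ 2 = n.+1%:R :> R by rewrite sqr_sqrtr.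
have -> : pow32 n.+1 = Num.sqrt n.+1%:R ^+ 3 by rewrite exprSr yy.
have yx : Num.sqrt n.+1%:R ^+ 2 = Num.sqrt n%:R ^+ 2 + 1 :> R by rewrite xx yy natr1.
move: (Num.sqrt n%:R) (Num.sqrt n.+1%:R) x0 y0 yx {xx yy} => x y x0 y0 yx.
have -> : 2 / x - 2 / y = 2 * (y ^+ 2 - x ^+ 2) / (x * y * (x + y)).
  by field; do 2?(apply/andP; split); lra.
rewrite yx addrAC subrr add0r mulr1 -[leLHS]mul1r ler_pdivrMr ?exprn_gt0 //.
rewrite mulrAC ler_pdivlMr ?mulr_gt0 ?addr_gt0 // mul1r.
have xy : x <= y by nra.
have : x * y <= y * y by rewrite ler_pM2r.
by nra.
Qed.

Lemma sum_invr_pow32_le D : \sum_(a <- digits D) (pow32 a)^-1 <= 3.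
Proof.
case: D => [|D]; first by rewrite /digits big_geq.
suff /le_trans : \sum_(a <- digits D.+1) (pow32 a)^-1 <= 3 - 2 / Num.sqrt D.+1%:R.
  by apply; rewrite gerBl divr_ge0 ?sqrtr_ge0.
rewrite /digits; elim: D => [|D IH].
  by rewrite big_nat1 /pow32 sqrtr1 mulr1 invr1; lra.
by rewrite big_nat_recr //=; have := invr_pow32_le (ltn0Sn D); lra.
Qed.

Lemma invr_pow32_continuant_le w : pos_digits w ->
  (pow32 (continuant w))^-1 <= \prod_(a <- w) (pow32 a)^-1.
Proof.
elim: w => [|a w IH] /=; first by rewrite big_nil /pow32 sqrtr1 mulr1 invr1.
move=> /andP[a0 w0]; rewrite big_cons.
apply: le_trans (ler_wpM2l _ (IH w0)); last by rewrite invr_ge0 pow32_ge0.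
have aw0 : (0 < a * continuant w)%N by rewrite muln_gt0 a0 continuant_gt0.
rewrite -invfM -pow32M lef_pV2 ?posrE ?ler_pow32 ?continuant_cons_ge ?pow32_gt0 //.
exact: leq_trans (continuant_cons_ge a w).
Qed.

Lemma short_words_count_pow32 k m (B : seq (seq nat)) : uniq B ->
  (forall w, w \in B -> [/\ pos_digits w, (continuant w <= m)%N & (size w < k)%N]) ->
  (size B)%:R <= pow32 m * 3 ^+ k :> R.
Proof.
move=> uB B_spec; pose rankin w : R := \prod_(a <- w) (pow32 a)^-1.
have rankin_ge0 w : 0 <= rankin w by apply: prodr_ge0 => a _; rewrite invr_ge0 pow32_ge0.
rewrite -sum1_size natr_sum.
apply: (@le_trans _ _ (\sum_(w <- B) (pow32 m * rankin w))).
  rewrite big_seq [leRHS]big_seq ler_sum // => w /B_spec[w0 wm _].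
  apply: le_trans (ler_wpM2l (pow32_ge0 m) (invr_pow32_continuant_le w0)).
  by rewrite ler_pdivlMr ?pow32_gt0 ?continuant_gt0 // mul1r ler_pow32.
rewrite -big_distrr /= ler_wpM2l ?pow32_ge0 //.
pose all_words := flatten [seq words (digits m) j | j <- index_iota 0 k].
apply: (@le_trans _ _ (\sum_(w <- all_words) rankin w)).
  apply: ler_sum_sub => // w /B_spec[w0 wm wk].
  apply/flatten_mapP; exists (size w); first by rewrite mem_index_iota.
  by rewrite mem_words eqxx all_digits_continuant.
rewrite /all_words big_flatten big_map.
elim: k {B_spec all_words} => [|k IH]; first by rewrite big_geq.
rewrite big_nat_recr //= sum_words_prod exprS.
have sum_ge0 : 0 <= \sum_(a <- digits m) (pow32 a)^-1.
  by apply: sumr_ge0 => a _; rewrite invr_ge0 pow32_ge0.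
have : (\sum_(a <- digits m) (pow32 a)^-1) ^+ k <= 3 ^+ k.
  by rewrite lerXn2r ?nnegrE // sum_invr_pow32_le.
have : 0 <= 3 ^+ k :> R by rewrite exprn_ge0.
lra.
Qed.

(* Summing [pow32] of the inverse continuants (Rankin's trick) beats the trivial
   bound [m ^ 2] by a power of [m] as long as [3 ^ k] is smaller than [sqrt m]. *)
Lemma short_words_count k m (B : seq (seq nat)) : (0 < k)%N -> (2 ^ (7 * k) <= m)%N -> uniq B ->
  (forall w, w \in B -> [/\ pos_digits w, (continuant w <= m)%N & (size w < k)%N]) ->
  (size B)%:R <= m%:R ^+ 2 / k%:R :> R.
Proof.
move=> k0 km uB B_spec; apply: le_trans (short_words_count_pow32 uB B_spec) _.
rewrite ler_pdivlMr ?ltr0n // /pow32 expr2 -!mulrA ler_wpM2l //.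
have k3 : k%:R <= 3 ^+ k :> R by rewrite -natrX ler_nat ltnW // ltn_expl.
have sqrt_ge : (9 : R) ^+ k <= Num.sqrt m%:R.
  rewrite -(ler_pXn2r (n := 2)) ?nnegrE ?exprn_ge0 ?sqrtr_ge0 // sqr_sqrtr //.
  rewrite -exprM mulnC exprM -natrX -natrX ler_nat; apply: leq_trans km.
  by rewrite expnM leq_exp2r.
rewrite -[leRHS]sqr_sqrtr // expr2 ler_wpM2l ?sqrtr_ge0 //; apply: le_trans sqrt_ge.
by rewrite (_ : 9 = 3 * 3) ?exprMn ?ler_wpM2l ?exprn_ge0 //; ring.
Qed.

End ShortWords.

Section AbnormalWords.
Context {R : realType}.
Variable s : seq nat.
Hypothesis s_gt0 : (0 < size s)%N.
Hypothesis s_pos : pos_digits s.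
Implicit Types (eps : R) (D K M h I m : nat) (u w : seq nat) (B : seq (seq nat)).

(* The cylinder of [w] has length at least [1 / (2 q ^ 2)] with [q := continuant w],
   while the squared continuants of the prefixes of one sequence sum to [2 m ^ 2]. *)
Lemma count_le_prefix_prob D K m B : (0 < D)%N -> (m <= D)%N -> uniq B ->
  (forall w, w \in B -> [/\ pos_digits w, (continuant w <= m)%N & (size w <= K)%N]) ->
  (size B)%:R <=
    4 * m%:R ^+ 2 * digit_expect D K 0 (fun u => (has (fun w => prefix w u) B)%:R) :> R.
Proof.
move=> D0 mD uB B_spec; have chain := @capped_prob_stochastic R D D0.
have z01 : in01 (0 : R) by rewrite /in01 lexx ler01.
have dominated t d : in01 t -> d \in digits D -> 0 <= @digit_prob R t d <= capped_prob D t d.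
  by move=> /andP[t0 _]; rewrite mem_digits => /andP[d0 _]; apply: digit_prob_le_capped.
apply: (@le_trans _ _ (\sum_(w <- B)
    digit_expect D K 0 (fun u => 2 * (continuant w)%:R ^+ 2 * (prefix w u)%:R))).
  rewrite -sum1_size natr_sum big_seq [leRHS]big_seq ler_sum // => w /B_spec[w0 wm wK].
  have wD := all_digits_continuant w0 (leq_trans wm mD).
  rewrite expectZ (expect_prefix chain) ?iota_uniq //.
  have q0 : 0 < 2 * (continuant w)%:R ^+ 2 :> R.
    by rewrite mulr_gt0 // exprn_gt0 // ltr0n continuant_gt0.
  rewrite mulrC -ler_pdivrMr // mul1r; apply: le_trans (digit_weight0_ge w0) _.
  by have /andP[] := path_weight_le chain dominated z01 wD.
rewrite -expect_sum -expectZ; apply: (le_expect chain) => // u /words_pos_digits u0.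
have [_|/hasPn noB] := boolP (has _ B); last first.
  by rewrite mulr0 big_seq big1 // => w /noB /negbTE ->; rewrite mulr0.
have Bm w : w \in B -> (continuant w <= m)%N by case/B_spec.
have := sum_continuant_prefix_le uB u0 Bm.
rewrite -(ler_nat R) natrM natrX natr_sum big_mkcond /= => sum_le.
rewrite mulr1; have -> : 4 * m%:R ^+ 2 = 2 * (2 * m%:R ^+ 2) :> R by ring.
apply: le_trans (ler_wpM2l _ sum_le) => //; rewrite big_distrr; apply: ler_sum => w _ /=.
by case: (prefix w u); rewrite ?mulr0 ?mulr1 // natrX.
Qed.

Lemma abnormal_grid_prefix eps M h I u w : 0 < eps -> 2 <= M%:R * eps -> (0 < M)%N -> (0 < h)%N ->
  (M * h <= size w <= I * h)%N -> abnormal s eps w -> prefix w u ->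
  has (fun i => abnormal s (eps / 2) (take (i * h) u)) (digits I).
Proof.
move=> e0 eM M0 h0 /andP[wM wI] w_abn wu; pose i := (size w %/ h)%N.
have iw : (i * h <= size w)%N by rewrite leq_trunc_div.
have wi : (size w < i * h + h)%N by rewrite /i -mulSnr -ltn_divLR.
apply/hasP; exists i.
  rewrite mem_digits; apply/andP; split; first by rewrite (leq_trans M0) // leq_divRL.
  by rewrite -(leq_pmul2r h0) (leq_trans iw).
have -> : take (i * h) u = take (i * h) w.
  by move: wu; rewrite prefixE => /eqP <-; rewrite take_takel.
apply: abnormal_take => //; have M0R : 0 < M%:R :> R by rewrite ltr0n.
rewrite -(ler_pM2l M0R); apply: (@le_trans _ _ (size w)%:R).
  by rewrite -natrM ler_nat (leq_trans _ wM) // leq_mul2l leq_subLR (ltnW wi) orbT.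
by have := ler_wpM2r (ler0n R (size w)) eM; lra.
Qed.

Lemma long_abnormal_words_count eps M h I m B :
  0 < eps -> 2 <= M%:R * eps -> (0 < M)%N -> (0 < h)%N -> uniq B ->
  (forall w, w \in B -> [/\ pos_digits w, (continuant w <= m)%N,
     (M * h <= size w <= I * h)%N & abnormal s eps w]) ->
  (size B)%:R <= 4 * m%:R ^+ 2 * (I%:R * (4 * (4 * (size s)%:R + 7) / (eps ^+ 2 * h%:R))).
Proof.
move=> e0 eM M0 h0 uB B_spec; pose K := (I * h)%N.
pose D := (m + \max_(d <- s) d + K ^ 2).+2; have D0 : (0 < D)%N by [].
have chain := @capped_prob_stochastic R D D0.
have z01 : in01 (0 : R) by rewrite /in01 lexx ler01.
have s_lt : all (fun d => d < D)%N s.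
  by apply/allP => d ds; have := @leq_bigmax_seq nat s xpredT id d ds isT; rewrite /D /=; lia.
apply: le_trans (@count_le_prefix_prob D K m B D0 _ uB _) _.
- by rewrite /D; lia.
- by move=> w /B_spec[w0 wm /andP[_ wK] _].
apply: ler_wpM2l; first by rewrite mulr_ge0 // exprn_ge0.
apply: (@le_trans _ _ (\sum_(i <- digits I)
    digit_expect D K 0 (fun u => (abnormal s (eps / 2) (take (i * h) u))%:R))).
  rewrite -expect_sum; apply: (le_expect chain) => // u _.
  have [/hasP[w wB wu]|_] := boolP (has _ B); last by rewrite sumr_ge0.
  have [w0 _ wMI w_abn] := B_spec w wB.
  have /hasP[i iI i_abn] := abnormal_grid_prefix e0 eM M0 h0 wMI w_abn wu.
  by rewrite (big_rem i) //= i_abn lerDl sumr_ge0.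
have h0R : 0 < h%:R :> R by rewrite ltr0n.
set C := 4 * (size s)%:R + 7; have C0 : 0 <= C by rewrite addr_ge0 ?mulr_ge0.
have bound_ge0 : 0 <= 4 * C / (eps ^+ 2 * h%:R).
  by rewrite divr_ge0 ?mulr_ge0 ?exprn_ge0 // ltW.
apply: (@le_trans _ _ (\sum_(i <- digits I) 4 * C / (eps ^+ 2 * h%:R))); last first.
  by rewrite /digits sumr_const_nat subSS subn0 [leRHS]mulr_natl.
rewrite big_seq [leRHS]big_seq; apply: ler_sum => i; rewrite mem_digits => /andP[i0 iI].
have i1 := @digit_ge1 R _ i0.
rewrite (expect_take chain (fun u => (abnormal s (eps / 2) u)%:R)) ?leq_mul2r ?iI ?orbT //.
apply: le_trans (expect_abnormal_le s_gt0 s_pos s_lt _ _ _ z01 _) _ => //.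
- by rewrite muln_gt0 i0.
- by apply: leq_trans (leqW (leqW (leq_addl _ _))); rewrite leq_exp2r ?leq_mul2r ?iI ?orbT.
- by rewrite divr_gt0.
rewrite natrM -/C.
have -> : C / ((eps / 2) ^+ 2 * (i%:R * h%:R)) = 4 * C / (eps ^+ 2 * h%:R) / i%:R.
  by field; do 2!(apply/andP; split; first by lra); lra.
by rewrite ler_pdivrMr ?ler_peMr //; lra.
Qed.

Lemma exists_expn2_scale k m : (0 < k)%N -> (2 ^ k <= m)%N ->
  exists2 h, (0 < h)%N & (2 ^ (k * h) <= m < 2 ^ (2 * k * h))%N.
Proof.
move=> k0 km; have k1 : (1 < 2 ^ k)%N by rewrite -{1}(expn0 2) ltn_exp2l.
have m0 : (0 < m)%N by apply: leq_trans km; rewrite ltnW.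
have h0 : (0 < trunc_log (2 ^ k) m)%N by apply: trunc_log_max; rewrite ?expn1.
exists (trunc_log (2 ^ k) m) => //; rewrite expnM trunc_logP //=.
by apply: leq_trans (trunc_log_ltn m k1) _; rewrite -expnM leq_exp2l //; nia.
Qed.

Lemma ln_le_log2 m n : (0 < m < 2 ^ n)%N -> ln (m%:R : R) <= n%:R.
Proof.
move=> /andP[m0 mn]; have ln2_le1 : ln (2 : R) <= 1.
  by have := @le_ln1Dx R 1; rewrite (_ : 1 + 1 = 2) //; apply; lra.
apply: (@le_trans _ _ (ln (2 ^+ n))).
  by rewrite ler_ln ?posrE ?exprn_gt0 ?ltr0n // -natrX ler_nat ltnW.
by rewrite lnXn // lerMn2r ln2_le1 orbT.
Qed.

Lemma abnormal_words_count eps : 0 < eps ->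
  exists2 C : R, 0 <= C & exists m0, forall m B, (m0 <= m)%N -> uniq B ->
    (forall w, w \in B -> [/\ pos_digits w, (continuant w <= m)%N & abnormal s eps w]) ->
    (size B)%:R <= C * (m%:R ^+ 2 / ln m%:R).
Proof.
move=> e0; have [M M0 eM] : exists2 M, (0 < M)%N & 2 <= M%:R * eps.
  by exists (Num.truncn (2 / eps)).+1 => //; rewrite -ler_pdivrMr // ltW // truncnS_gt.
pose C1 : R := 4 * ((28 * M)%:R * (4 * (4 * (size s)%:R + 7) / eps ^+ 2)).
have C1_ge0 : 0 <= C1.
  have : 0 <= 4 * (size s)%:R + 7 :> R by rewrite addr_ge0 ?mulr_ge0.
  by move=> ?; rewrite /C1; do !apply: mulr_ge0 => //; rewrite invr_ge0 exprn_ge0 // ltW.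
exists ((1 + C1) * (14 * M)%:R); first by rewrite mulr_ge0 ?addr_ge0.
exists (2 ^ (7 * M))%N => m B mM uB B_spec.
have [|h h0 /andP[hm mh]] := @exists_expn2_scale (7 * M) m _ mM; first by rewrite muln_gt0.
rewrite (_ : 2 * (7 * M) = 14 * M)%N in mh; last by ring.
have m1 : (1 < m)%N by apply: leq_trans mM; rewrite -{1}(expn0 2) ltn_exp2l // muln_gt0.
pose long w := (M * h <= size w)%N.
have -> : size B = (size [seq w <- B | ~~ long w] + size [seq w <- B | long w])%N.
  by rewrite !size_filter addnC count_predC.
have h0R : 0 < h%:R :> R by rewrite ltr0n.
have short_count : (size [seq w <- B | ~~ long w])%:R <= m%:R ^+ 2 / h%:R :> R.
  apply: (@le_trans _ _ (m%:R ^+ 2 / (M * h)%:R)).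
    apply: short_words_count; rewrite ?filter_uniq ?muln_gt0 ?M0 ?mulnA //.
    by move=> w; rewrite mem_filter -ltnNge => /andP[wM /B_spec[]].
  by rewrite ler_wpM2l ?exprn_ge0 // lef_pV2 ?posrE ?ltr0n ?muln_gt0 ?M0 // ler_nat leq_pmull.
have long_count : (size [seq w <- B | long w])%:R <= C1 * (m%:R ^+ 2 / h%:R).
  apply: le_trans (@long_abnormal_words_count eps M h (28 * M) m _ e0 eM M0 h0 _ _) _.
  - exact: filter_uniq.
  - move=> w; rewrite mem_filter => /andP[wM /B_spec[w0 wm w_abn]]; split=> //.
    have := leq_ltn_trans (leq_trans (expn2_half_le_continuant w0) wm) mh.
    rewrite ltn_exp2l // ltn_half_double => /ltnW size_le.
    apply/andP; split=> //.
    by rewrite (_ : 28 * M * h = (14 * M * h).*2)%N // -muln2; ring.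
  by rewrite le_eqVlt /C1; apply/orP; left; apply/eqP; field; apply/andP; split; lra.
have lnm0 : 0 < ln (m%:R : R) by rewrite ln_gt0 // ltr1n.
have lnm : ln (m%:R : R) <= (14 * M * h)%:R.
  by apply: ln_le_log2; rewrite (ltnW m1).
have : h%:R^-1 <= (14 * M)%:R / ln m%:R :> R.
  by rewrite ler_pdivlMr // mulrC ler_pdivrMr // -natrM.
move=> /(ler_wpM2l (mulr_ge0 (addr_ge0 ler01 C1_ge0) (exprn_ge0 2 (ler0n R m)))).
rewrite natrD; lra.
Qed.

End AbnormalWords.

(** * Enumeration of the rationals *)

Definition reduced_fraction (r : nat * nat) : bool := (0 < r.1 < r.2)%N && coprime r.1 r.2.

Lemma cf_greedy_spec fuel p q : (p < q)%N -> (p < fuel)%N -> coprime p q ->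
  pos_digits (cf_greedy fuel p q) /\ cf_frac (cf_greedy fuel p q) = (p, q).
Proof.
elim: fuel p q => // fuel IH p q pq pf cpq /=; case: eqVneq => [p0|p0] /=.
  by move: cpq; rewrite p0 /coprime gcd0n => /eqP ->.
have p_gt0 : (0 < p)%N by lia.
have qp : (q %% p < p)%N by rewrite ltn_mod.
have [|||-> ->] := IH (q %% p)%N p; [by []|by lia|by rewrite coprime_modl coprime_sym|].
by rewrite divn_gt0 // ltnW //= -divn_eq.
Qed.

Lemma cf_rat_spec r : reduced_fraction r -> pos_digits (cf_rat r) /\ cf_frac (cf_rat r) = r.
Proof.
case: r => p q /andP[/andP[/= p0 pq] cpq]; rewrite /cf_rat.
have [] := @cf_greedy_spec q.+1 p q pq (leqW pq) cpq.
case: (cf_greedy _ _ _) => // a w; rewrite lastI.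
move: (belast a w) (last a w) => v l; case: ifP => // l1.
rewrite /pos_digits !all_rcons -!cats1 => /andP[_ v0] <-; split.
  by rewrite v0 /= -subn1 subn_gt0 l1.
rewrite -catA; apply: cf_frac_cat => /=.
by rewrite !muln1 !addn0 addn1 prednK // ltnW.
Qed.

Lemma Lcf_gt0 r : reduced_fraction r -> (0 < Lcf r)%N.
Proof.
move=> red; have [_] := cf_rat_spec red; rewrite /Lcf; case: (cf_rat r) => // rE.
by move: red; rewrite -rE.
Qed.

Lemma mem_rat_list Q r : (r \in rat_list Q) = (r.2 <= Q.+1)%N && reduced_fraction r.
Proof.
case: r => p q; apply/flatten_mapP/idP => [[q']|].
  rewrite mem_iota => qQ /mapP[p']; rewrite mem_filter mem_iota => /andP[cpq pq] [-> ->].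
  by rewrite /reduced_fraction cpq andbT /=; lia.
move=> /and3P[/= qQ pq cpq]; exists q; first by rewrite mem_iota; lia.
by apply/mapP; exists p => //; rewrite mem_filter cpq mem_iota; lia.
Qed.

Lemma rat_listS Q :
  rat_list Q.+1 = rat_list Q ++ [seq (p, Q.+2) | p <- iota 1 Q.+1 & coprime p Q.+2].
Proof. by rewrite /rat_list -{1}(addn1 Q) iotaD map_cat flatten_cat /= cats0. Qed.

Lemma prefix_rat_list Q Q' : (Q <= Q')%N -> prefix (rat_list Q) (rat_list Q').
Proof.
move=> /subnKC <-; elim: (Q' - Q)%N => [|n IH]; first by rewrite addn0 prefix_refl.
by rewrite addnS rat_listS prefix_catl.
Qed.

Lemma rat_list_uniq Q : uniq (rat_list Q).
Proof.
elim: Q => // Q IH; rewrite rat_listS cat_uniq IH; apply/and3P; split => //.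
  by apply/hasPn => _ /mapP[p _ ->]; rewrite mem_rat_list ltnn.
by rewrite map_inj_uniq ?filter_uniq ?iota_uniq // => p p' [].
Qed.

Lemma size_rat_list_ge Q : (Q <= size (rat_list Q))%N.
Proof.
elim: Q => // Q IH; rewrite rat_listS size_cat size_map -addn1 leq_add //.
rewrite size_filter -has_count; apply/hasP.
by exists 1%N; rewrite ?coprime1n // mem_iota; lia.
Qed.

Lemma rseqE Q i : (0 < i <= size (rat_list Q))%N -> rseq i = nth (0, 1)%N (rat_list Q) i.-1.
Proof.
move=> /andP[i0 iQ]; rewrite /rseq; have ii := size_rat_list_ge i.
by have [/prefix_rat_list|/ltnW/prefix_rat_list] := leqP i Q;
  move=> /prefixP[r ->]; rewrite nth_cat ifT //; lia.
Qed.

Lemma mem_rseq Q i : (0 < i <= size (rat_list Q))%N -> rseq i \in rat_list Q.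
Proof. by move=> iQ; rewrite (rseqE iQ) mem_nth //; case: i iQ. Qed.

Lemma reduced_rseq i : (0 < i)%N -> reduced_fraction (rseq i).
Proof.
move=> i0; have := @mem_rseq i i; rewrite i0 size_rat_list_ge mem_rat_list.
by move=> /(_ isT) /andP[].
Qed.

Lemma rseq_inj Q i j : (0 < i <= size (rat_list Q))%N -> (0 < j <= size (rat_list Q))%N ->
  rseq i = rseq j -> i = j.
Proof.
move=> iQ jQ; rewrite (rseqE iQ) (rseqE jQ) => /eqP; move: iQ jQ.
case: i j => [|i] [|j] //= iQ jQ.
by rewrite nth_uniq ?rat_list_uniq // => /eqP ->.
Qed.

Definition fraction_pairs n : seq (nat * nat) := [seq (p, q) | q <- iota 1 n, p <- iota 1 q.-1].

Lemma mem_fraction_pairs n r : (r \in fraction_pairs n) = (0 < r.1 < r.2)%N && (r.2 <= n)%N.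
Proof.
case: r => p q; apply/allpairsPdep/idP => [[q' [p' []]]|/andP[/= pq qn]].
  by rewrite !mem_iota => ? ? [-> ->] /=; lia.
by exists q, p; rewrite !mem_iota; split=> //; lia.
Qed.

Lemma fraction_pairs_uniq n : uniq (fraction_pairs n).
Proof.
apply: allpairs_uniq_dep => [|q _|]; try exact: iota_uniq.
by move=> [q p] [q' p'] _ _ /= [-> ->].
Qed.

Lemma size_fraction_pairs n : (2 * size (fraction_pairs n) = n * n.-1)%N.
Proof.
rewrite size_allpairs_dep; elim: n => // n IH.
rewrite -{1}(addn1 n) iotaD map_cat sumn_cat mulnDr IH /= size_iota.
by case: n {IH} => // n; nia.
Qed.

Lemma size_rat_list_le Q : (size (rat_list Q) <= Q.+1 ^ 2)%N.
Proof.
have : (size (rat_list Q) <= size (fraction_pairs Q.+1))%N.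
  apply: uniq_leq_size; first exact: rat_list_uniq.
  by move=> r; rewrite mem_rat_list mem_fraction_pairs => /and3P[-> ->].
by have := size_fraction_pairs Q.+1; rewrite -mulnn /=; nia.
Qed.

(* A pair with greatest common divisor [d] is [d] times another pair. *)
Lemma size_noncoprime_pairs_le_sum n :
  (size [seq r <- fraction_pairs n | ~~ coprime r.1 r.2]
     <= \sum_(2 <= d < n.+1) size (fraction_pairs (n %/ d)))%N.
Proof.
pose multiples d := [seq (d * r.1, d * r.2)%N | r <- fraction_pairs (n %/ d)].
apply: (@leq_trans (size (flatten [seq multiples d | d <- index_iota 2 n.+1]))); last first.
  rewrite size_flatten /shape sumnE !big_map; apply/eq_leq/eq_bigr => d _.
  by rewrite size_map.
apply: uniq_leq_size; first by rewrite filter_uniq ?fraction_pairs_uniq.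
move=> [p q]; rewrite mem_filter mem_fraction_pairs /= => /and3P[cpq /andP[p0 pq] qn].
have g0 : (0 < gcdn p q)%N by rewrite gcdn_gt0 p0.
have g1 : (1 < gcdn p q)%N by move: cpq; rewrite /coprime; lia.
have gq : (gcdn p q <= q)%N by rewrite dvdn_leq ?dvdn_gcdr //; lia.
have pE : (gcdn p q * (p %/ gcdn p q) = p)%N by rewrite mulnC divnK ?dvdn_gcdl.
have qE : (gcdn p q * (q %/ gcdn p q) = q)%N by rewrite mulnC divnK ?dvdn_gcdr.
apply/flatten_mapP; exists (gcdn p q); first by rewrite mem_index_iota; lia.
apply/mapP; exists (p %/ gcdn p q, q %/ gcdn p q)%N; last by rewrite /= pE qE.
rewrite mem_fraction_pairs leq_div2r //= andbT; apply/andP; split; first by nia.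
by rewrite -(ltn_pmul2l g0) pE qE.
Qed.

Lemma sum_inv_sq_le (R : realFieldType) n :
  \sum_(2 <= d < n) (d%:R ^+ 2)^-1 <= 3 / 4 :> R.
Proof.
case: n => [|n]; first by rewrite big_geq //; lra.
have [n2|n2] := leqP n 1; first by rewrite big_geq //; lra.
suff /le_trans : \sum_(2 <= d < n.+1) (d%:R ^+ 2)^-1 <= 3 / 4 - n%:R^-1 :> R.
  by apply; rewrite gerBl invr_ge0.
elim: n n2 => // n IH; rewrite ltnS leq_eqVlt => /orP[/eqP <-|n2].
  by rewrite big_nat1; lra.
rewrite big_nat_recr ?leqW //=; have {}IH := IH n2.
have n0 : 0 < n%:R :> R by rewrite ltr0n ltnW.
suff step : (n.+1%:R ^+ 2)^-1 <= n%:R^-1 - n.+1%:R^-1 :> R.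
  by apply: le_trans (lerD IH step) _; rewrite addrA subrK.
have -> : n%:R^-1 - n.+1%:R^-1 = (n%:R * n.+1%:R)^-1 :> R.
  by rewrite -natr1; field; apply/andP; split; lra.
by rewrite expr2 lef_pV2 ?posrE ?mulr_gt0 // ?ler_wpM2r ?ler_nat.
Qed.

Lemma size_noncoprime_pairs_le n :
  (8 * size [seq r <- fraction_pairs n | ~~ coprime r.1 r.2] <= 3 * n ^ 2)%N.
Proof.
rewrite -(ler_nat rat) [(3 * _)%:R]natrM natrX natrM.
have := size_noncoprime_pairs_le_sum n; rewrite -(ler_nat rat) natr_sum => noncoprime_le.
have pairs_le d : (1 < d)%N ->
    (size (fraction_pairs (n %/ d)))%:R <= n%:R ^+ 2 / 2 * (d%:R ^+ 2)^-1 :> rat.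
  move=> d1; have d0 : 0 < d%:R :> rat by rewrite ltr0n ltnW.
  have := size_fraction_pairs (n %/ d); move: (size _) => k kE.
  rewrite ler_pdivlMr ?exprn_gt0 // ler_pdivlMr // -natrX -!natrM -natrX ler_nat.
  have := leq_trunc_div n d; nia.
have : \sum_(2 <= d < n.+1) (size (fraction_pairs (n %/ d)))%:R <=
    \sum_(2 <= d < n.+1) n%:R ^+ 2 / 2 * (d%:R ^+ 2)^-1 :> rat.
  by apply: ler_sum_nat => d /andP[d2 _]; apply: pairs_le.
have n2 : 0 <= n%:R ^+ 2 :> rat by rewrite exprn_ge0.
by rewrite -big_distrr /=; have := ler_wpM2l n2 (sum_inv_sq_le rat n.+1); lra.
Qed.

Lemma size_rat_list_ge_sq Q : (7 <= Q)%N -> (Q.+1 ^ 2 <= 16 * size (rat_list Q))%N.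
Proof.
move=> Q7; have : (size (fraction_pairs Q.+1) <= size (rat_list Q) +
    size [seq r <- fraction_pairs Q.+1 | ~~ coprime r.1 r.2])%N.
  rewrite -(count_predC (fun r => coprime r.1 r.2)) -!size_filter leq_add2r.
  apply: uniq_leq_size; first by rewrite filter_uniq ?fraction_pairs_uniq.
  move=> r; rewrite mem_filter mem_fraction_pairs mem_rat_list => /and3P[cr r12 ->].
  by rewrite /reduced_fraction r12.
have := size_noncoprime_pairs_le Q.+1; have := size_fraction_pairs Q.+1.
move: (size _) (size _) (size _) => a b c /=; rewrite -mulnn; nia.
Qed.

Lemma exists_rat_list_level N : (64 < N)%N ->
  exists2 Q, (N <= size (rat_list Q))%N & (Q.+1 ^ 2 <= 64 * N)%N.
Proof.
move=> N64; have ex : exists Q, (N <= size (rat_list Q))%N by exists N; apply: size_rat_list_ge.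
case: (ex_minnP ex) => Q NQ Qmin; exists Q => //.
have Q7 : (7 < Q)%N.
  rewrite ltnNge; apply/negP => Q7; have := size_rat_list_le Q.
  have : (Q.+1 ^ 2 <= 8 ^ 2)%N by rewrite leq_exp2r.
  by lia.
have : (Q ^ 2 <= 16 * N)%N.
  case: Q NQ Qmin Q7 => // Q NQ Qmin Q7; apply: leq_trans (size_rat_list_ge_sq Q7) _.
  by rewrite leq_mul2l /= leqNgt; apply/negP => /ltnW /Qmin; rewrite ltnn.
have : (Q.+1 ^ 2 <= (2 * Q) ^ 2)%N by rewrite leq_exp2r //; lia.
by rewrite expnMn; lia.
Qed.

Lemma abnormal_rseq_count (R : realType) s (eps : R) : (0 < size s)%N -> pos_digits s -> 0 < eps ->
  exists C : R, exists M : nat, forall N : nat, (M <= N)%N ->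
    (count_upto (fun i => abnormal s eps (cf_rat (rseq i))) N)%:R <= C * N%:R / ln (N%:R : R).
Proof.
move=> s0 s_pos e0; have [C C0 [m0 words_count]] := abnormal_words_count s0 s_pos e0.
exists (128 * C), (m0 ^ 2 + 65)%N => N MN; rewrite /count_upto; set bad := (X in count X).
have [Q NQ Q64] := exists_rat_list_level (leq_trans (leq_addl _ _) MN).
have NQ2 := leq_trans NQ (size_rat_list_le Q).
have m0Q : (m0 <= Q.+1)%N.
  by rewrite -(@leq_exp2r _ _ 2) // (leq_trans _ NQ2) // (leq_trans _ MN) ?leq_addr.
pose B := [seq cf_rat (rseq i) | i <- iota 1 N & bad i].
have badP i : i \in [seq i <- iota 1 N | bad i] -> (0 < i <= size (rat_list Q))%N /\ bad i.
  by rewrite mem_filter mem_iota => /andP[-> /andP[i0 iN]]; split => //; lia.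
have cf_frac_rseq i : (0 < i)%N -> cf_frac (cf_rat (rseq i)) = rseq i.
  by move=> /reduced_rseq/cf_rat_spec[].
have uB : uniq B.
  rewrite map_inj_in_uniq ?filter_uniq ?iota_uniq // => i j /badP[iQ _] /badP[jQ _] ij.
  apply: (rseq_inj iQ jQ); case/andP: iQ => i0 _; case/andP: jQ => j0 _.
  by rewrite -(cf_frac_rseq i i0) ij cf_frac_rseq.
have B_spec w : w \in B -> [/\ pos_digits w, (continuant w <= Q.+1)%N & abnormal s eps w].
  move=> /mapP[i /badP[iQ bad_i] ->]; have := mem_rseq iQ; rewrite mem_rat_list => /andP[iQ1 red].
  by have [w0 fracE] := cf_rat_spec red; split; rewrite // /continuant fracE.
have := words_count Q.+1 B m0Q uB B_spec; rewrite size_map size_filter => /le_trans; apply.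
have N1 : (1 < N)%N by lia.
have lnN : 0 < ln (N%:R : R) by rewrite ln_gt0 // ltr1n.
have lnNQ : ln (N%:R : R) <= 2 * ln Q.+1%:R.
  rewrite mulr_natl -lnXn ?ltr0n // ler_ln ?posrE ?exprn_gt0 ?ltr0n //; last exact: ltnW.
  by rewrite -natrX ler_nat.
have lnQ : 0 < ln (Q.+1%:R : R) by lra.
have -> : 128 * C * N%:R / ln N%:R = C * (64 * N%:R * (2 / ln N%:R)) :> R by ring.
rewrite ler_wpM2l // ler_pM ?exprn_ge0 ?invr_ge0 ?(ltW lnQ) //.
  by rewrite -natrX -natrM ler_nat.
by rewrite ler_pdivlMr // mulrC ler_pdivrMr.
Qed.

(** * Cylinders and digits of real numbers *)

Section RealDigits.
Context {R : realType}.
Implicit Types (x y : R) (d : nat) (s w : seq nat).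
Local Notation mu := (@lebesgue_measure R).

Lemma gauss_map_digit y d : (0 < d)%N -> 0 <= y < 1 ->
  gauss_map (d%:R + y)^-1 = y /\ cf_digit (d%:R + y)^-1 1 = d.
Proof.
move=> d0 /andP[y0 y1]; have d1 := @digit_ge1 R _ d0.
rewrite /cf_digit /gauss_map /= invr_eq0 invrK; split; last first.
  by apply: truncn_def; rewrite -natr1 lerDl y0 ltrD2l.
rewrite ifF; last by apply/negbTE/lt0r_neq0; lra.
have -> : Num.floor (d%:R + y) = d%:Z.
  by apply: floor_def; rewrite intrD -!pmulrn lerDl y0 ltrD2l.
by rewrite -pmulrn addrC addKr.
Qed.

Lemma cf_digitS x i : cf_digit x i.+2 = cf_digit (gauss_map x) i.+1.
Proof. by rewrite /cf_digit !succnK iterSr. Qed.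

Lemma cylinder_cons d s y : (0 < d)%N -> 0 <= y < 1 -> (d%:R + y)^-1 < 1 ->
  cylinder (d :: s) (d%:R + y)^-1 <-> cylinder s y.
Proof.
move=> d0 y01 x1; have [gauss_y digit_d] := gauss_map_digit d0 y01.
have d1 := @digit_ge1 R _ d0; have /andP[y0 _] := y01; split=> -[_ digits_s]; split => //.
- by move=> j js; have := digits_s j.+1 js; rewrite cf_digitS gauss_y.
- by rewrite x1 invr_ge0 addr_ge0.
- by case=> [|j] js; [exact: digit_d|rewrite cf_digitS gauss_y; exact: digits_s].
Qed.

Lemma cylinder_sub_itv s : pos_digits s ->
  @cylinder R s `<=` `[(cylinder_ends s).1, (cylinder_ends s).2].
Proof.
elim: s => [_ x [/andP[x0 x1] _]|d s IH /andP[d0 s0] x xs] /=.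
  by rewrite in_itv /= x0 ltW.
have [/andP[x0 x1] digits_s] := xs; have := digits_s 0%N isT; rewrite /cf_digit /= => digit_d.
have {x0}x0 : 0 < x.
  rewrite lt_neqAle x0 andbT; apply/eqP => xE.
  by move: d0; rewrite -digit_d -xE invr0 truncn0.
have d1 := @digit_ge1 R _ d0.
have := @truncn_itv _ x^-1; rewrite invr_ge0 (ltW x0) digit_d -natr1 => /(_ isT)/andP[dx xd].
pose y := x^-1 - d%:R; have y01 : 0 <= y < 1 by rewrite /y; apply/andP; split; lra.
have xE : x = (d%:R + y)^-1 by rewrite /y addrCA subrr addr0 invrK.
have : cylinder s y by apply/(cylinder_cons s d0 y01); rewrite -xE.
move=> /(IH s0); rewrite /= !in_itv /= => /andP[y_lo y_hi].
have [? ? ?] := @cylinder_ends_bounds R s s0; have /andP[y0 _] := y01.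
by rewrite xE /next_ratio !lef_pV2 ?posrE; [apply/andP; split| | | |]; lra.
Qed.

Lemma itv_sub_cylinder s : pos_digits s ->
  `](cylinder_ends s).1, (cylinder_ends s).2[ `<=` @cylinder R s.
Proof.
elim: s => [_ x|d s IH /andP[d0 s0] x] /=; rewrite in_itv /= => /andP[x_lo x_hi].
  by split; [rewrite ltW|].
have d1 := @digit_ge1 R _ d0; have [lo0 lohi hi1] := @cylinder_ends_bounds R s s0.
have next0 : 0 < next_ratio (cylinder_ends s).2 d :> R by rewrite invr_gt0; lra.
have x0 : 0 < x by lra.
rewrite /next_ratio in x_lo x_hi next0.
have xV_lo : d%:R + (cylinder_ends s).1 < x^-1.
  by rewrite -[ltLHS]invrK ltf_pV2 ?posrE ?invr_gt0; lra.
have xV_hi : x^-1 < d%:R + (cylinder_ends s).2.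
  by rewrite -[ltRHS]invrK ltf_pV2 ?posrE ?invr_gt0; lra.
pose y := x^-1 - d%:R; have y01 : 0 <= y < 1 by rewrite /y; apply/andP; split; lra.
have xE : x = (d%:R + y)^-1 by rewrite /y addrCA subrr addr0 invrK.
rewrite xE; apply/cylinder_cons => //.
  by rewrite -xE; apply: lt_le_trans x_hi _; rewrite invf_le1; lra.
by apply: IH => //=; rewrite in_itv /= /y; apply/andP; split; lra.
Qed.

Lemma integral_between_itv (f : R -> R) (a b : R) (A : set R) :
  `]a, b[ `<=` A -> A `<=` `[a, b] -> measurable_fun `[a, b] f -> 
  (\int[mu]_(x in A) (f x)%:E = \int[mu]_(x in `[a, b]) (f x)%:E)%E.
Proof.
move=> oA Ac /measurable_EFinP mf.
have setD_ends : (A `\ a) `\ b = `]a, b[%classic.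
  apply/seteqP; split=> x /=; rewrite in_itv /=.
    move=> [[Ax /eqP xa] /eqP xb]; have := Ac x Ax; rewrite /= in_itv /= !lt_neqAle => /andP[-> ->].
    by rewrite xb eq_sym xa.
  move=> xab; have /andP[ax xb] := xab; split; [split|] => [|xE|xE].
  - by apply: oA; rewrite /= in_itv.
  - by rewrite xE ltxx in ax.
  - by rewrite xE ltxx in xb.
have mAa : measurable (A `\ a).
  have [Ab|nAb] := pselect ((A `\ a) b).
    by rewrite -(setD1K Ab) setD_ends; apply: measurableU => //; exact: measurable_set1.
  by rewrite -(not_setD1 nAb) setD_ends.
have mf_sub (B : set R) : B `<=` A -> measurable_fun B (EFin \o f).
  by move=> BA; apply: (measurable_funS _ (subset_trans BA Ac) mf).
rewrite -(@integral_setD1 _ (EFin \o f) a) //; last by apply: mf_sub => x [].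
rewrite -(@integral_setD1 _ (EFin \o f) b) setD_ends //; last exact: mf_sub.
by rewrite [RHS]integral_itv_bndoo //; apply: mf_sub.
Qed.

Lemma gauss_measure_cylinder s : pos_digits s ->
  gauss_measure (@cylinder R s) = (gauss_prob s)%:E.
Proof.
move=> s0; have [lo0 lohi hi1] := @cylinder_ends_bounds R s s0; rewrite /gauss_measure.
set a := (cylinder_ends s).1 in lo0 lohi; set b := (cylinder_ends s).2 in lohi hi1.
pose F u : R := ln (1 + u * 1) / ln 2.
have derF (t : R) : 0 <= t -> is_derive t 1 F ((1 + t)^-1 / ln 2).
  move=> t0; have t1 : 0 < 1 + t * 1 by lra.
  refine (is_derive_eq (is_deriveM (is_derive_ln1M t1) (is_derive_cst _ _ _)) _).
  by rewrite scaler0 add0r /GRing.scale /= !mulr1 mul1r mulrC.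
have contF (t : R) : 0 <= t -> {for t, continuous F}.
  move=> t0; apply/differentiable_continuous/derivable1_diffP.
  by have [] := derF t t0.
have cont_density : {within `[a, b], continuous (fun y : R => (1 + y)^-1 / ln 2)}.
  apply: derivable_within_continuous => x; rewrite in_itv /= => /andP[xa _].
  apply: derivableM => //; apply: derivableV; first by apply/lt0r_neq0; lra.
  exact: derivableD.
rewrite (@integral_between_itv _ a b); first last.
- exact: subspace_continuous_measurable_fun.
- exact: cylinder_sub_itv.
- exact: itv_sub_cylinder.
rewrite (@continuous_FTC2 _ _ F) //.
- by rewrite -EFinB /gauss_prob /F !mulr1 mulrBl.
- split; last by apply: cvg_at_left_filter; apply: contF; lra.
    by move=> x; rewrite in_itv /= => /andP[ax _]; have [] := derF x (ltW (le_lt_trans lo0 ax)).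
  by apply: cvg_at_right_filter; apply: contF.
- move=> x; rewrite in_itv /= => /andP[ax _]; rewrite derive1E.
  by have [_ ->] := derF x (ltW (le_lt_trans lo0 ax)).
Qed.

(* The left ends of the cylinders of the prefixes increase to a point that lies
   in the interior of every one of them. *)
Lemma exists_cf_digits (a : nat -> nat) : (forall i, 0 < a i)%N ->
  exists x : R, 0 <= x < 1 /\ forall i, cf_digit x i.+1 = a i.
Proof.
move=> a0; pose lo n : R := (cylinder_ends (mkseq a n)).1.
pose hi n : R := (cylinder_ends (mkseq a n)).2.
have pos w n m : w = [seq a i | i <- iota n m] -> pos_digits w.
  by move=> ->; apply/allP => _ /mapP[i _ ->].
have inside n m : (n.+1 < m)%N -> lo n < lo m /\ hi m < hi n.
  move=> nm; have splitE : mkseq a m = mkseq a n ++ [seq a i | i <- iota n (m - n)].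
    by rewrite /mkseq -map_cat -{2}[n]add0n -iotaD subnKC // ltnW // ltnW.
  rewrite /lo /hi splitE; apply: cylinder_ends_cat; try exact: pos.
  by rewrite size_map size_iota; lia.
have lo_hi n m : lo n <= hi m.
  have [|lo_n _] := inside n (n + m).+2; first by lia.
  have [|_ hi_m] := inside m (n + m).+2; first by lia.
  have [_ lohi _] := @cylinder_ends_bounds R _ (pos (mkseq a (n + m).+2) _ _ erefl).
  by apply: ltW; apply: lt_trans (lt_trans lohi hi_m).
pose x := sup (range lo).
have x_bounds n : lo n <= x <= hi n.
  apply/andP; split.
    by apply: ub_le_sup; [exists (hi 0%N) => _ [k _ <-]; exact: lo_hi|exists n].
  by apply: ge_sup; [exists (lo 0%N); exists 0%N|move=> _ [k _ <-]; exact: lo_hi].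
have x_cylinder n : cylinder (mkseq a n) x.
  apply: itv_sub_cylinder; first exact: pos.
  have [lo_lt hi_lt] := inside n n.+2 (ltnSn _); have /andP[lo_x x_hi] := x_bounds n.+2.
  by rewrite /= in_itv /= (lt_le_trans lo_lt) ?(le_lt_trans x_hi).
exists x; split=> [|i]; first by case: (x_cylinder 0%N).
by have [_ /(_ i)] := x_cylinder i.+1; rewrite size_mkseq nth_mkseq // => ->.
Qed.

End RealDigits.

(** * Concatenated expansions *)

Section Frequency.
Context {R : realType}.
Variables (x : R) (s : seq nat).
Hypothesis s_gt0 : (0 < size s)%N.

Definition digit_word N : seq nat := mkseq (fun i => cf_digit x i.+1) N.

Lemma occ_count_bounds N :
  (occ s (digit_word N) <= occ_count s N x <= occ s (digit_word N) + size s)%N.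
Proof.
suff -> : occ_count s N x =
    count (fun i => mkseq (fun j => cf_digit x (i + j).+1) (size s) == s) (iota 0 N).
  exact: occ_mkseq.
rewrite /occ_count -[1%N]/(1 + 0)%N iotaDl count_map; apply: eq_count => i /=.
apply/allP/eqP => [digits_s|/(congr1 (fun w => nth 0%N w)) digits_s j].
  apply: (@eq_from_nth _ 0%N); rewrite size_mkseq // => j js.
  by rewrite nth_mkseq //; apply/eqP; rewrite -add1n addnA digits_s // mem_iota.
by rewrite mem_iota => js; rewrite -digits_s nth_mkseq // addnA.
Qed.

Lemma occ_frequency_cvg :
  (forall eps : R, 0 < eps -> \forall N \near \oo,
    `|discrepancy s (digit_word N)| <= eps * N%:R) ->
  (fun N => (occ_count s N x)%:R / N%:R : R) @ \oo --> (gauss_prob s : R).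
Proof.
move=> disc_small; apply/cvgrPdist_le => e e0; have e2 : 0 < e / 2 by rewrite divr_gt0.
have : \forall N \near \oo, (size s)%:R <= e / 2 * N%:R :> R.
  have := nbhs_infty_ger ((size s)%:R / (e / 2)).
  by apply: filterS => N; rewrite ler_pdivrMr // mulrC.
apply: filterS3 (nbhs_infty_gt 0) (disc_small _ e2) => N N0.
rewrite /discrepancy size_mkseq => disc_le s_le.
have N0R : 0 < N%:R :> R by rewrite ltr0n.
have /andP[] := occ_count_bounds N; rewrite -!(ler_nat R) natrD => lower upper.
have -> : gauss_prob s - (occ_count s N x)%:R / N%:R =
    - (((occ_count s N x)%:R - gauss_prob s * N%:R) / N%:R) :> R by field; lra.
rewrite normrN normrM normfV (ger0_norm (ltW N0R)) ler_pdivrMr //.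
by move: disc_le; rewrite !ler_norml => /andP[? ?]; apply/andP; split; lra.
Qed.

End Frequency.

Section Concatenation.
Variable f : nat -> nat.
Hypothesis f_gt0 : forall n, (0 < n)%N -> (0 < f n)%N.
Local Notation block n := (cf_rat (rseq (f n))).

Lemma xf_prefixS n : xf_prefix f n.+1 = xf_prefix f n ++ block n.+1.
Proof. by rewrite /xf_prefix -{1}(addn1 n) iotaD map_cat flatten_cat /= cats0. Qed.

Lemma SL_S n : SL f n.+1 = (SL f n + Lcf (rseq (f n.+1)))%N.
Proof. by rewrite /SL big_nat_recr. Qed.

Lemma ML_S n : ML f n.+1 = maxn (ML f n) (Lcf (rseq (f n.+1))).
Proof. by rewrite /ML big_nat_recr. Qed.

Lemma size_xf_prefix n : size (xf_prefix f n) = SL f n.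
Proof.
elim: n => [|n IH]; first by rewrite /SL big_geq.
by rewrite xf_prefixS size_cat IH SL_S.
Qed.

Lemma prefix_xf_prefix n m : (n <= m)%N -> prefix (xf_prefix f n) (xf_prefix f m).
Proof.
move=> /subnKC <-; elim: (m - n)%N => [|k IH]; first by rewrite addn0 prefix_refl.
by rewrite addnS xf_prefixS prefix_catl.
Qed.

Lemma SL_ge n : (n <= SL f n)%N.
Proof.
elim: n => // n IH; rewrite SL_S.
by have := Lcf_gt0 (reduced_rseq (f_gt0 (ltn0Sn n))); lia.
Qed.

Lemma nth_xf_prefix n i : (i < SL f n)%N -> nth 0%N (xf_prefix f n) i = xf_digit f i.+1.
Proof.
move=> iS; rewrite /xf_digit /=; have ii := SL_ge i.+1.
by have [/prefix_xf_prefix|/ltnW/prefix_xf_prefix] := leqP n i.+1;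
  move=> /prefixP[r ->]; rewrite nth_cat size_xf_prefix ifT.
Qed.

Lemma xf_digit_gt0 i : (0 < xf_digit f i.+1)%N.
Proof.
have pos n : pos_digits (xf_prefix f n).
  elim: n => // n IH; rewrite xf_prefixS pos_digits_cat IH.
  by have [] := cf_rat_spec (reduced_rseq (f_gt0 (ltn0Sn n))).
have ii := SL_ge i.+1; rewrite -(nth_xf_prefix ii).
by apply: (allP (pos i.+1)); rewrite mem_nth // size_xf_prefix.
Qed.

Lemma exists_block_index N n0 : (SL f n0 <= N)%N ->
  exists2 n, (n0 <= n)%N & (SL f n <= N < SL f n.+1)%N.
Proof.
move=> n0N; have leN n : (SL f n <= N)%N -> (n <= N)%N by apply: leq_trans (SL_ge n).
case: (ex_maxnP (ex_intro _ n0 n0N) leN) => n nN n_max; exists n; first exact: n_max.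
by rewrite nN ltnNge; apply/negP => /n_max; rewrite ltnn.
Qed.

Section Normality.
Context {R : realType}.
Variables (s : seq nat) (x : R).
Hypothesis s_gt0 : (0 < size s)%N.
Hypothesis s_pos : pos_digits s.
Hypothesis x_digits : forall i, (0 < i)%N -> cf_digit x i = xf_digit f i.
Implicit Types eps : R.

Local Notation abnormal_blocks eps := (count_upto (fun n => abnormal s eps (block n))).

Lemma digit_word_SL n : digit_word x (SL f n) = xf_prefix f n.
Proof.
apply: (@eq_from_nth _ 0%N); rewrite size_mkseq ?size_xf_prefix // => i iS.
by rewrite nth_mkseq // x_digits // nth_xf_prefix.
Qed.

Lemma discrepancy_xf_prefix eps n : 0 <= eps ->
  `|discrepancy s (xf_prefix f n) : R| <=
    (n * size s)%:R + eps * (SL f n)%:R + (abnormal_blocks eps n * ML f n)%:R.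
Proof.
move=> e0; elim: n => [|n IH].
  by rewrite /discrepancy /= mulr0 subrr normr0 !addr_ge0 ?mulr_ge0.
set w := block n.+1; set bad := abnormal s eps w.
have block_le : `|discrepancy s w : R| <= eps * (size w)%:R + (bad * ML f n.+1)%:R.
  rewrite /bad /abnormal; case: ltP => [_|//]; last by rewrite mul0n addr0.
  rewrite mul1n (le_trans (discrepancy_le_size s_pos w)) // ler_wpDl ?mulr_ge0 //.
  by rewrite ler_nat ML_S leq_maxr.
have blocksS : (abnormal_blocks eps n.+1 * ML f n.+1)%:R =
    (abnormal_blocks eps n * ML f n.+1)%:R + (bad * ML f n.+1)%:R :> R.
  by rewrite -natrD -mulnDl /count_upto -{1}(addn1 n) iotaD count_cat /= addn0.
have ML_mono : (abnormal_blocks eps n * ML f n)%:R <= (abnormal_blocks eps n * ML f n.+1)%:R :> R.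
  by rewrite ler_nat leq_mul2l ML_S leq_maxl orbT.
have := @discrepancy_cat R s (xf_prefix f n) w; rewrite -xf_prefixS.
rewrite blocksS SL_S -/w mulSnr natrD [X in eps * X]natrD.
have := lerB_dist (discrepancy s (xf_prefix f n.+1) : R)
  (discrepancy s (xf_prefix f n) + discrepancy s w).
have := ler_normD (discrepancy s (xf_prefix f n) : R) (discrepancy s w).
have -> : Lcf (rseq (f n.+1)) = size w by [].
lra.
Qed.

Lemma discrepancy_digit_word_sub N n : (SL f n <= N < SL f n.+1)%N ->
  `|discrepancy s (digit_word x N) - discrepancy s (xf_prefix f n)| <= (ML f n.+1)%:R :> R.
Proof.
move=> /andP[nN Nn]; rewrite -digit_word_SL -(subnKC nN) /digit_word /mkseq iotaD map_cat.
apply: le_trans (discrepancy_catr s_gt0 s_pos _ _) _.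
rewrite size_map size_iota ler_nat ML_S (leq_trans _ (leq_maxr _ _)) //.
by move: Nn; rewrite SL_S; lia.
Qed.

Hypothesis few_blocks : forall eps, 0 < eps -> \forall n \near \oo, n%:R <= eps * (SL f n)%:R.
Variable C : R.
Hypothesis C_gt0 : 0 < C.
Hypothesis balanced_blocks : \forall n \near \oo, n%:R * (ML f n)%:R <= C * (SL f n)%:R.
Hypothesis abnormal_sparse : forall eps, 0 < eps ->
  density_zero (R := R) (fun n => abnormal s eps (block n)).

Lemma ML_littleo eps : 0 < eps -> \forall n \near \oo, (ML f n.+1)%:R <= eps * (SL f n)%:R.
Proof.
move=> e0; have := nbhs_infty_ger (C + C / eps).
have : \forall n \near \oo, n.+1%:R * (ML f n.+1)%:R <= C * (SL f n.+1)%:R.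
  by case: balanced_blocks => M _ bal; exists M => // n Mn; apply: bal; apply: leqW.
apply: filterS2 => n bal n_ge.
have S_le : (SL f n.+1)%:R <= (SL f n)%:R + (ML f n.+1)%:R :> R.
  by rewrite -natrD ler_nat SL_S leq_add2l ML_S leq_maxr.
have M0 : 0 <= (ML f n.+1)%:R :> R by [].
have : C / eps * (ML f n.+1)%:R <= C * (SL f n)%:R.
  have := ler_wpM2l (ltW C_gt0) S_le; have := ler_wpM2r M0 n_ge.
  by move: bal; rewrite -natr1; lra.
by rewrite -mulrA ler_pM2l // mulrC ler_pdivrMr // mulrC.
Qed.

Lemma abnormal_blocks_littleo eps del : 0 < eps -> 0 < del ->
  \forall n \near \oo, (abnormal_blocks eps n * ML f n)%:R <= del * (SL f n)%:R :> R.
Proof.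
move=> e0 d0; have dC : 0 < del / C by rewrite divr_gt0.
have /cvgrPdist_le/(_ _ dC) := abnormal_sparse e0.
apply: filterS3 (nbhs_infty_gt 0) balanced_blocks => n n0 bal.
have n0R : 0 < n%:R :> R by rewrite ltr0n.
rewrite sub0r normrN ger0_norm ?divr_ge0 // ler_pdivrMr // => count_le.
rewrite natrM; apply: le_trans (ler_wpM2r (ler0n _ _) count_le) _.
have := ler_wpM2l (ltW dC) bal; rewrite !mulrA => /le_trans; apply.
by rewrite divfK // lt0r_neq0.
Qed.

Lemma discrepancy_xf_prefix_littleo eps : 0 < eps ->
  \forall n \near \oo, `|discrepancy s (xf_prefix f n) : R| <= eps * (SL f n)%:R.
Proof.
move=> e0; have e3 : 0 < eps / 3 by rewrite divr_gt0.
have l0 : 0 < (size s)%:R :> R by rewrite ltr0n.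
apply: filterS2 (few_blocks (divr_gt0 e3 l0)) (abnormal_blocks_littleo e3 e3) => n n_le bad_le.
apply: le_trans (discrepancy_xf_prefix n (ltW e3)) _.
have : (n * size s)%:R <= eps / 3 * (SL f n)%:R :> R.
  have := ler_wpM2r (ltW l0) n_le; rewrite natrM => /le_trans; apply.
  by rewrite mulrAC divfK // lt0r_neq0.
lra.
Qed.

Lemma discrepancy_digit_word_littleo eps : 0 < eps ->
  \forall N \near \oo, `|discrepancy s (digit_word x N)| <= eps * N%:R.
Proof.
move=> e0; have e2 : 0 < eps / 2 by rewrite divr_gt0.
have [n0 _ near_n] := filterI (ML_littleo e2) (discrepancy_xf_prefix_littleo e2).
exists (SL f n0) => // N /= /exists_block_index[n /near_n/= [ML_le disc_le] nN].
have := discrepancy_digit_word_sub nN; have /andP[+ _] := nN; rewrite -(ler_nat R) => SLN.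
have := lerB_dist (discrepancy s (digit_word x N) : R) (discrepancy s (xf_prefix f n)).
by have := ler_wpM2l (ltW e0) SLN; lra.
Qed.

End Normality.
End Concatenation.

Theorem theorem1p1 (R : realType) (f : nat -> nat)
  (hf : forall n : nat, (0 < n)%N -> (0 < f n)%N)
  (h_o : forall eps : R, 0 < eps ->
          exists M : nat, forall N : nat, (M <= N)%N -> (N%:R : R) <= eps * (SL f N)%:R)
  (h_O : exists C : R, exists M : nat, forall N : nat, (M <= N)%N ->
          ((N * ML f N)%N%:R : R) <= C * (SL f N)%:R)
  (h_S : forall S : pred nat,
          (exists C : R, exists M : nat, forall N : nat, (M <= N)%N ->
             ((count_upto S N)%:R : R) <= C * N%:R / ln (N%:R : R)) ->
          @density_zero R (fun n => S (f n))) :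
  (exists x : R, 0 <= x < 1 /\ forall i : nat, (0 < i)%N -> cf_digit x i = xf_digit f i)
  /\ (forall x : R, 0 <= x < 1 -> (forall i : nat, (0 < i)%N -> cf_digit x i = xf_digit f i) ->
        CF_normal x).
Proof.
split.
  have [x [x01 x_digits]] := @exists_cf_digits R _ (xf_digit_gt0 hf).
  by exists x; split=> //; case.
move=> x x01 x_digits s s_gt0 s_pos; rewrite gauss_measure_cylinder //.
apply: cvg_EFin; first exact: nearW.
have few_blocks eps : 0 < eps -> \forall n \near \oo, n%:R <= eps * (SL f n)%:R :> R.
  by move=> /h_o[M few]; exists M.
have [C [M ML_le]] := h_O; have C1_gt0 : 0 < `|C| + 1 by rewrite ltr_wpDl.
have balanced : \forall n \near \oo, n%:R * (ML f n)%:R <= (`|C| + 1) * (SL f n)%:R :> R.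
  exists M => // n /ML_le; rewrite natrM => /le_trans; apply.
  by rewrite ler_wpM2r // ler_wpDr // ler_norm.
apply: (occ_frequency_cvg s_gt0) => eps.
apply: (discrepancy_digit_word_littleo hf s_gt0 s_pos x_digits few_blocks C1_gt0 balanced).
by move=> del del_gt0; exact: h_S (abnormal_rseq_count s_gt0 s_pos del_gt0).
Qed.
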